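(* Let $n \in \mathbb{N}$ with $n\ge 3$, and let $\delta, \epsilon \in (0, 2^{-4})$. Let $T$ be any estimator, with sample counts $\{N_{\{i,j,k\}}\}$, such that $$N_{i^*, j^*} \leq \epsilon^{-2}\log(1/\delta)/4 \quad \text{for some } i^* \neq j^* \in [n].$$ Then there exist two choice models $(\mathbf{0}, \Sigma^1)$ and $(\mathbf{0}, \Sigma^2)$, with $\Sigma^1,\Sigma^2$ normalized, such that $$\operatorname{Tr}(\Sigma^1) = \operatorname{Tr}(\Sigma^2) = n \quad\text{and}\quad \|\Sigma^1 - \Sigma^2\|_\infty \geq \epsilon,$$ and $$\max_{\Sigma \in \{\Sigma^1, \Sigma^2\}} \Pr_{\mathbf{X} \sim (T, \mathrm{Choice}(\mathbf{0}, \Sigma))}\left\{\|T(\mathbf{X}) - \Sigma\|_\infty \geq \frac{\epsilon}{4}\right\} \geq \delta.$$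
   Context: For $\mu\in\mathbb{R}^n$ and $\Sigma\in\mathbb{R}^{n\times n}$ symmetric positive semidefinite, $\mathrm{Choice}(\mu,\Sigma)$ is the probit choice model with utilities $X\sim\mathcal{N}(\mu,\Sigma)$. Parameters are normalized as follows: $\langle \mu,\mathbf{1}\rangle=0$, $\Sigma\mathbf{1}=0$, $\operatorname{Tr}(\Sigma)=n$, and $\operatorname{rank}(\Sigma)=n-1$. An estimator $T$ is specified by nonnegative integers $N_{\{i,j,k\}}$, one for each 3-element subset $\{i,j,k\}\subseteq[n]$. For each such triple, independently, it obtains $N_{\{i,j,k\}}$ samples of the ordering of $(X_i,X_j,X_k)$, where each sample uses a fresh $X\sim\mathcal{N}(\mu,\Sigma)$. It then outputs an estimate $T(\mathbf{X})$ of $\Sigma$ from all collected samples $\mathbf{X}$. For distinct $i,j$, define $N_{i,j} := \sum_{k\notin\{i,j\}} N_{\{i,j,k\}}$. $\|\cdot\|_\infty$ denotes the entrywise maximum absolute value. *)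

(* Defs.v *)
From HB Require Import structures.
From mathcomp Require Import all_boot all_order all_algebra all_fingroup.
From mathcomp Require Import all_classical all_reals all_analysis.
Set Implicit Arguments. Unset Strict Implicit. Unset Printing Implicit Defensive.
Import Order.TTheory GRing.Theory Num.Theory.
Local Open Scope ring_scope.

Section Defs.
Variables (R : realType) (n : nat).

(* 3-element subsets {i,j,k} of [n], represented by their increasing listing i<j<k *)
Definition Trip := {t : 'I_n * 'I_n * 'I_n | (t.1.1 < t.1.2)%N && (t.1.2 < t.2)%N}.

Definition trip_idx (t : Trip) : 3.-tuple 'I_n :=
  [tuple (val t).1.1; (val t).1.2; (val t).2].

Definition in_trip (t : Trip) (i : 'I_n) : bool := i \in trip_idx t.

Definition maxnorm (A : 'M[R]_n) : R :=
  \big[Num.max/0]_(i < n) \big[Num.max/0]_(j < n) `|A i j|.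

Definition psd (S : 'M[R]_n) : Prop :=
  forall v : 'cV[R]_n, 0 <= (v^T *m S *m v) 0 0.

Definition normalized (mu : 'cV[R]_n) (S : 'M[R]_n) : Prop :=
  [/\ \sum_(i < n) mu i 0 = 0, S^T = S, psd S,
      S *m (const_mx 1 : 'cV[R]_n) = 0 & \tr S = n%:R /\ \rank S = n.-1].

(* An ordering of (X_i,X_j,X_k) for t = {i<j<k}: a permutation s of 'I_3,
   meaning X_{t_(s 0)} > X_{t_(s 1)} > X_{t_(s 2)}. *)
Definition ordered3 (y : 'cV[R]_3) (s : 'S_3) : bool :=
  (y (s 1%R) 0 < y (s 0%R) 0) && (y (s 2%R) 0 < y (s 1%R) 0).

(* Probability that, for X ~ N(mu, S), the ordering of (X_i,X_j,X_k) is s.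
   (X_i,X_j,X_k) ~ N(mu_t, S_t) is realized as mu_t + B z, z ~ N(0, I_3),
   with B any matrix with B B^T = S_t (exists since S_t is PSD). *)
Definition sub3 (t : Trip) (S : 'M[R]_n) : 'M[R]_3 :=
  \matrix_(a < 3, b < 3) S (tnth (trip_idx t) a) (tnth (trip_idx t) b).

Definition ordprob (mu : 'cV[R]_n) (S : 'M[R]_n) (t : Trip) (s : 'S_3) : R :=
  let St := sub3 t S in
  let mt : 'cV[R]_3 := \col_(a < 3) mu (tnth (trip_idx t) a) 0 in
  match pselect (exists B : 'M[R]_3, B *m B^T = St) with
  | left ex =>
      let B := projT1 (cid ex) in
      fine (\int[lebesgue_measure]_z0 \int[lebesgue_measure]_z1
              \int[lebesgue_measure]_z2
               ((normal_pdf 0 1 z0 * normal_pdf 0 1 z1 * normal_pdf 0 1 z2 *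
                (if ordered3 (mt + B *m (\col_(a < 3) [:: z0; z1; z2]`_a)) s
                 then 1 else 0))%:E))%E
  | right _ => 0
  end.

Definition Data (N : Trip -> nat) := {dffun forall t : Trip, (N t).-tuple 'S_3}.

Definition data_prob (N : Trip -> nat) (mu : 'cV[R]_n) (S : 'M[R]_n)
  (d : Data N) : R :=
  \prod_(t : Trip) \prod_(a < N t) ordprob mu S t (tnth (d t) a).

Definition data_Pr (N : Trip -> nat) (mu : 'cV[R]_n) (S : 'M[R]_n)
  (E : pred (Data N)) : R :=
  \sum_(d : Data N | E d) data_prob mu S d.

Definition Npair (N : Trip -> nat) (i j : 'I_n) : nat :=
  \sum_(t : Trip | in_trip t i && in_trip t j) N t.

End Defs.

(* Main.v *)
Require Import Defs.
From HB Require Import structures.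
From mathcomp Require Import all_boot all_order all_algebra all_fingroup.
From mathcomp Require Import all_classical all_reals all_analysis.
From mathcomp Require Import measurable_realfun ring lra.
Set Implicit Arguments. Unset Strict Implicit. Unset Printing Implicit Defensive.
Import Order.TTheory GRing.Theory Num.Theory.
Local Open Scope ring_scope.

(** The two models are centered, rescaled versions of the covariances [I] and
    [I + x M], where [(i, j)] is the undersampled pair,
    [M = e_i e_j^T + e_j e_i^T] and [x = 3 eps / 2]. For a Gaussian vector, the
    ordering of three coordinates depends only on the variances of their
    pairwise differences, up to a common factor. Passing from [I] to [I + x M] changes only one of these variances,
    that of the pair [(i, j)], so triples that do not contain both [i] and
    [j] carry no information.

    An ordering has the probability of a planar Gaussian wedge, by rotation
    invariance; this probability is Lipschitz in the slope of the wedge. In the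
    first model all orderings have probability 1/6, so in a triple containing
    [i] and [j] the chi-square divergence is at most [4 x^2 / 3 = 3 eps^2].
    It tensorizes to [exp (3 eps^2 N_{i,j}) <= delta^(-3/4)], and the
    Cauchy-Schwarz inequality rules out that both errors are below [delta]. *)

(** * Translations, shears and rotations of planar Lebesgue measure *)

Section LebesgueShear.
Variable R : realType.
Local Notation mu := (@lebesgue_measure R).
Local Open Scope classical_set_scope.
Local Open Scope ring_scope.
Local Open Scope ereal_scope.

(** Lebesgue measure is determined by its values on half-open intervals, and translation preserves
    their length. *)
Lemma lebesgue_measure_shift (c : R) (A : set R) : measurable A ->
  pushforward mu ((fun x => x + c)%R : _ -> measurableTypeR R) A = mu A.
Proof.
have mc : measurable_fun (setT : set (measurableTypeR R))
    ((fun x => x + c)%R : measurableTypeR R -> measurableTypeR R).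
  exact: measurable_funD.
pose h := isMeasurableFun.Build _ _ _ _ _ mc.
pose p : {mfun _ >-> _} := HB.pack ((fun x => x + c)%R : measurableTypeR R -> measurableTypeR R) h.
move=> mA; apply/esym/(@lebesgue_measure_unique _ (pushforward mu p)) => //= _ [[a b]] _ <-.
rewrite /pushforward /=.
rewrite (_ : _ @^-1` _ = `](a - c)%R, (b - c)%R]%classic); last first.
  by apply/seteqP; split => x /=; rewrite !in_itv /=; lra.
rewrite !lebesgue_measure_itv/= !lte_fin ltrD2r; case: ifP => // _.
by rewrite -!EFinB; congr EFin; ring.
Qed.

Lemma integral_shift (c : R) (f : R -> \bar R) : measurable_fun setT f ->
  (forall x, 0 <= f x) -> \int[mu]_x f (x + c)%R = \int[mu]_x f x.
Proof.
move=> mf f0.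
have mc : measurable_fun (setT : set (measurableTypeR R))
    ((fun x => x + c)%R : measurableTypeR R -> measurableTypeR R).
  exact: measurable_funD.
pose h := isMeasurableFun.Build _ _ _ _ _ mc.
pose p : {mfun _ >-> _} := HB.pack ((fun x => x + c)%R : measurableTypeR R -> measurableTypeR R) h.
have := @ge0_integral_pushforward _ _ _ _ R p mc mu setT f measurableT mf (fun y _ => f0 y).
rewrite preimage_setT => <-.
by apply: eq_measure_integral => A mA _; exact: lebesgue_measure_shift.
Qed.

Lemma integral_shear_y (t : R) (F : R * R -> \bar R) : measurable_fun setT F ->
  (forall z, 0 <= F z) ->
  \int[mu]_x \int[mu]_y F (x, y + t * x)%R = \int[mu]_x \int[mu]_y F (x, y).
Proof.
move=> mF F0; apply: eq_integral => x _.
apply: (integral_shift (t * x) (f := fun y => F (x, y))) => //.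
exact: measurableT_comp.
Qed.

(** The shear translates the outer variable, so Tonelli's theorem exchanges the integrals before and
    after the translation. *)
Lemma integral_shear_x (t : R) (F : R * R -> \bar R) : measurable_fun setT F ->
  (forall z, 0 <= F z) ->
  \int[mu]_x \int[mu]_y F (x + t * y, y)%R = \int[mu]_x \int[mu]_y F (x, y).
Proof.
move=> mF F0.
pose G (z : R * R) := F (z.1 + t * z.2, z.2)%R.
have mG : measurable_fun setT G.
  apply: measurableT_comp => //; apply: measurable_fun_pair => //=.
  by apply: measurable_funD => //; apply: measurable_funM.
transitivity (\int[mu]_y \int[mu]_x G (x, y)).
  exact: (@fubini_tonelli _ _ _ _ R mu mu G mG (fun=> F0 _)).
transitivity (\int[mu]_y \int[mu]_x F (x, y)); last first.
  exact/esym/(@fubini_tonelli _ _ _ _ R mu mu F mF F0).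
apply: eq_integral => y _.
apply: (integral_shift (t * y) (f := fun x => F (x, y))) => //.
exact: measurableT_comp.
Qed.

(* A rotation by an angle [u <> pi] is a product of three shears, with
   [t = tan (u / 2) = s / (1 + c)]; the half-turn is two quarter-turns. *)
Lemma integral_rotation (c s : R) (F : R * R -> \bar R) :
  (c ^+ 2 + s ^+ 2 = 1)%R -> measurable_fun setT F -> (forall z, 0 <= F z) ->
  \int[mu]_x \int[mu]_y F (c * x - s * y, s * x + c * y)%R =
  \int[mu]_x \int[mu]_y F (x, y).
Proof.
wlog c1 : c s F / (1 + c != 0)%R => [hw|].
  have [c1|c1] := eqVneq (1 + c)%R 0%R; last exact: hw.
  have cE : c = (-1)%R by lra.
  move=> + mF F0; rewrite cE => s1.
  have sE : s = 0%R.
    by apply/eqP; rewrite -sqrf_eq0; apply/eqP; move: s1; rewrite sqrrN expr1n; lra.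
  have n10 : (1 + 0 != 0 :> R)%R by rewrite addr0 oner_neq0.
  have e : (0 ^+ 2 + 1 ^+ 2 = 1 :> R)%R by ring.
  pose G (z : R * R) := F (0 * z.1 - 1 * z.2, 1 * z.1 + 0 * z.2)%R.
  have mG : measurable_fun setT G.
    apply: measurableT_comp => //; apply: measurable_fun_pair => /=.
    - by apply: measurable_funB; apply: measurable_funM.
    - by apply: measurable_funD; apply: measurable_funM.
  rewrite -(hw _ _ F n10 e mF F0) -(hw _ _ G n10 e mG (fun=> F0 _)) sE.
  apply: eq_integral => x _; apply: eq_integral => y _.
  by rewrite /G /=; congr F; congr pair; ring.
move=> cs1 mF F0; pose t := (s / (1 + c))%R.
have ts : (t * s = 1 - c)%R.
  have -> : (t * s = s ^+ 2 / (1 + c))%R by rewrite /t; field.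
  by rewrite (_ : s ^+ 2 = (1 - c) * (1 + c))%R ?mulfK//; lra.
have tc : (t * (1 + c) = s)%R by rewrite divfK.
pose F1 (z : R * R) := F (z.1 + - t * z.2, z.2)%R.
pose F2 (z : R * R) := F1 (z.1, z.2 + s * z.1)%R.
have mF1 : measurable_fun setT F1.
  apply: measurableT_comp => //; apply: measurable_fun_pair => //=.
  by apply: measurable_funD => //; apply: measurable_funM.
have mF2 : measurable_fun setT F2.
  apply: measurableT_comp => //; apply: measurable_fun_pair => //=.
  by apply: measurable_funD => //; apply: measurable_funM.
rewrite -(integral_shear_x (- t) mF F0).
rewrite -(integral_shear_y s mF1 (fun=> F0 _)).
rewrite -(integral_shear_x (- t) mF2 (fun=> F0 _)).
apply: eq_integral => x _; apply: eq_integral => y _.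
rewrite /F2 /F1 /=; congr F; congr pair.
- transitivity ((1 - t * s) * x - (t * (1 + (1 - t * s))) * y)%R; last by ring.
  by rewrite ts subKr tc.
- transitivity (s * x + (1 - t * s) * y)%R; last by ring.
  by rewrite ts subKr.
Qed.

End LebesgueShear.

(** * Rotation invariance of Gaussian integrals and reduction to the plane *)

Section GaussianSpace.
Variable R : realType.
Local Notation mu := (@lebesgue_measure R).
Local Notation phi := (@normal_pdf R 0 1).
Local Open Scope classical_set_scope.
Local Open Scope ring_scope.
Local Open Scope ereal_scope.

Lemma normal_pdf_rotation (c s x y : R) : (c ^+ 2 + s ^+ 2 = 1)%R ->
  (phi (c * x - s * y) * phi (s * x + c * y) = phi x * phi y)%R.
Proof.
move=> cs; rewrite normal_pdfE ?oner_neq0// mulrACA [RHS]mulrACA; congr (_ * _)%R.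
rewrite /normal_fun -!expRD; congr expR; rewrite !subr0 !expr1n.
rewrite -!mulrDl; congr (_ / _)%R; rewrite -!opprD; congr (- _)%R.
transitivity ((c ^+ 2 + s ^+ 2) * (x ^+ 2 + y ^+ 2))%R; first by ring.
by rewrite cs mul1r.
Qed.

Definition gauss2 (h : R * R -> R) : \bar R :=
  \int[mu]_x \int[mu]_y (phi x * phi y * h (x, y))%:E.

(** The nesting and the order of the factors copy the integral in [ordprob], so that only integrands
    remain to be compared. *)
Definition gauss3 (h : R * R * R -> R) : \bar R :=
  \int[mu]_x \int[mu]_y \int[mu]_z (phi x * phi y * phi z * h (x, y, z))%:E.

Section Rotations.
Variable h : R * R * R -> R.
Hypothesis mh : measurable_fun setT h.
Hypothesis h0 : forall z, (0 <= h z)%R.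

Let f (z : R * R * R) := (phi z.1.1 * phi z.1.2 * phi z.2 * h z)%:E.

Let f0 z : 0 <= f z.
Proof. by rewrite lee_fin !mulr_ge0 ?normal_pdf_ge0. Qed.

Let mf : measurable_fun setT f.
Proof.
apply/measurable_EFinP; apply: measurable_funM => //.
apply: measurable_funM; first apply: measurable_funM.
- apply: (measurableT_comp (measurable_normal_pdf 0 1)).
  exact: measurableT_comp.
- apply: (measurableT_comp (measurable_normal_pdf 0 1)).
  exact: measurableT_comp.
- exact: (measurableT_comp (measurable_normal_pdf 0 1)).
Qed.

Lemma gauss3_rotation_yz (c s : R) : (c ^+ 2 + s ^+ 2 = 1)%R ->
  gauss3 (fun p => h (p.1.1, c * p.1.2 - s * p.2, s * p.1.2 + c * p.2)%R) =
  gauss3 h.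
Proof.
move=> cs; apply: eq_integral => x _.
pose F (p : R * R) := f (x, p.1, p.2).
have mF : measurable_fun setT F.
  apply: measurableT_comp => //; apply: measurable_fun_pair => //.
  exact: measurable_fun_pair.
rewrite -[RHS](integral_rotation cs mF (fun=> f0 _)).
apply: eq_integral => y _; apply: eq_integral => z _; congr EFin.
by rewrite /= -!mulrA; congr (_ * _)%R; rewrite !mulrA normal_pdf_rotation.
Qed.

(** Integrating out the innermost variable leaves a function on the plane, to which planar rotation
    invariance applies. *)
Lemma gauss3_rotation_xy (c s : R) : (c ^+ 2 + s ^+ 2 = 1)%R ->
  gauss3 (fun p => h (c * p.1.1 - s * p.1.2, s * p.1.1 + c * p.1.2, p.2)%R) =
  gauss3 h.
Proof.
move=> cs; pose F := fubini_F mu f.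
have mF : measurable_fun setT F by exact: measurable_fun_fubini_tonelli_F.
have F0 p : 0 <= F p by apply: integral_ge0.
rewrite -[RHS](integral_rotation cs mF F0).
apply: eq_integral => x _; apply: eq_integral => y _; apply: eq_integral => z _.
by rewrite /f /= normal_pdf_rotation.
Qed.

End Rotations.

Lemma gauss3E (h : R * R -> R) : measurable_fun setT h ->
  (forall z, (0 <= h z)%R) -> gauss3 (h \o fst) = gauss2 h.
Proof.
move=> mh h0; apply: eq_integral => x _; apply: eq_integral => y _ /=.
transitivity (\int[mu]_z ((phi x * phi y * h (x, y))%:E * (phi z)%:E)).
  by apply: eq_integral => z _; rewrite -EFinM; congr EFin; ring.
rewrite ge0_integralZl//=.
- by rewrite integral_normal_pdf mule1.
- by apply/measurable_EFinP; exact: measurable_normal_pdf.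
- by move=> z _; rewrite lee_fin normal_pdf_ge0.
- by rewrite lee_fin !mulr_ge0 ?normal_pdf_ge0.
Qed.

(** [(c, s)] is the direction of [(a, b)]: turning back by its angle puts the vector on the
    nonnegative first axis. The zero vector needs no rotation. *)
Lemma exists_rotation_to_axis (a b : R) : exists c s : R,
  [/\ (c ^+ 2 + s ^+ 2 = 1)%R, (c * b - s * a = 0)%R &
      (0 <= c * a + s * b)%R].
Proof.
have [ab0|ab0] := eqVneq (a ^+ 2 + b ^+ 2)%R 0%R.
  exists 1%R, 0%R.
  have a0 : a = 0%R.
    by apply/eqP; rewrite -sqrf_eq0; apply/eqP; have := sqr_ge0 a; have := sqr_ge0 b; lra.
  have b0 : b = 0%R.
    by apply/eqP; rewrite -sqrf_eq0; apply/eqP; have := sqr_ge0 a; have := sqr_ge0 b; lra.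
  by rewrite a0 b0; split; lra.
have abge0 : (0 <= a ^+ 2 + b ^+ 2)%R by rewrite addr_ge0 ?sqr_ge0.
pose r := Num.sqrt (a ^+ 2 + b ^+ 2).
have r2 : (r ^+ 2 = a ^+ 2 + b ^+ 2)%R by rewrite sqr_sqrtr.
have r0 : (0 < r)%R by rewrite sqrtr_gt0 lt0r ab0.
have rn0 : r != 0%R by rewrite gt_eqF.
exists (a / r)%R, (b / r)%R; split.
- by rewrite !exprMn exprVn -mulrDl -r2 divff// sqrf_eq0.
- by ring.
- rewrite (_ : _ + _ = (a ^+ 2 + b ^+ 2) / r)%R; last by ring.
  by rewrite divr_ge0// ltW.
Qed.

(** Serves both as a linear form in [z] and as the inner product of two coefficient vectors. *)
Definition lin3 (a : R * R * R) (z : R * R * R) : R :=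
  (a.1.1 * z.1.1 + a.1.2 * z.1.2 + a.2 * z.2)%R.

Lemma measurable_lin3 a : measurable_fun setT (lin3 a).
Proof.
apply: measurable_funD; first apply: measurable_funD.
- by apply: measurable_funM => //; exact: measurableT_comp.
- by apply: measurable_funM => //; exact: measurableT_comp.
- exact: measurable_funM.
Qed.

(* [a] and [b] are brought to the [x]-axis and the [xy]-plane by rotations. *)
Lemma gauss3_lin3 (psi : R * R -> R) (a b : R * R * R) :
  measurable_fun setT psi -> (forall z, (0 <= psi z)%R) ->
  exists alpha beta gam : R, [/\ (0 <= alpha)%R, (0 <= gam)%R,
    (alpha ^+ 2 = lin3 a a)%R, (alpha * beta = lin3 a b)%R &
    (beta ^+ 2 + gam ^+ 2 = lin3 b b)%R /\
    gauss3 (fun z => psi (lin3 a z, lin3 b z)) =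
    gauss2 (fun z => psi (alpha * z.1, beta * z.1 + gam * z.2)%R)].
Proof.
move=> mpsi psi0.
have mlin u v : measurable_fun setT (fun z => psi (lin3 u z, lin3 v z)).
  apply: measurableT_comp => //.
  by apply: measurable_fun_pair; exact: measurable_lin3.
(* [ryz] and [rxy] are transposed rotations: turning the Gaussian vector amounts to turning the
   coefficients back, which preserves their inner products. *)
pose ryz (c s : R) (u : R * R * R) : R * R * R :=
  (u.1.1, c * u.1.2 + s * u.2, c * u.2 - s * u.1.2)%R.
pose rxy (c s : R) (u : R * R * R) : R * R * R :=
  (c * u.1.1 + s * u.1.2, c * u.1.2 - s * u.1.1, u.2)%R.
have gryz c s u v : (c ^+ 2 + s ^+ 2 = 1)%R ->
    gauss3 (fun z => psi (lin3 u z, lin3 v z)) =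
    gauss3 (fun z => psi (lin3 (ryz c s u) z, lin3 (ryz c s v) z)).
  move=> cs; rewrite -(gauss3_rotation_yz (mlin u v) (fun=> psi0 _) cs).
  congr gauss3; apply/funext => z; congr psi.
  by rewrite /lin3 /ryz /=; congr pair; ring.
have grxy c s u v : (c ^+ 2 + s ^+ 2 = 1)%R ->
    gauss3 (fun z => psi (lin3 u z, lin3 v z)) =
    gauss3 (fun z => psi (lin3 (rxy c s u) z, lin3 (rxy c s v) z)).
  move=> cs; rewrite -(gauss3_rotation_xy (mlin u v) (fun=> psi0 _) cs).
  congr gauss3; apply/funext => z; congr psi.
  by rewrite /lin3 /rxy /=; congr pair; ring.
have iryz c s u v : (c ^+ 2 + s ^+ 2 = 1)%R ->
    lin3 (ryz c s u) (ryz c s v) = lin3 u v.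
  move=> cs; rewrite /lin3 /ryz /=.
  transitivity (u.1.1 * v.1.1 + (c ^+ 2 + s ^+ 2) * (u.1.2 * v.1.2 + u.2 * v.2))%R.
    by ring.
  by rewrite cs; ring.
have irxy c s u v : (c ^+ 2 + s ^+ 2 = 1)%R ->
    lin3 (rxy c s u) (rxy c s v) = lin3 u v.
  move=> cs; rewrite /lin3 /rxy /=.
  transitivity ((c ^+ 2 + s ^+ 2) * (u.1.1 * v.1.1 + u.1.2 * v.1.2) + u.2 * v.2)%R.
    by ring.
  by rewrite cs; ring.
have [c1 [s1 [cs1 z1 _]]] := exists_rotation_to_axis a.1.2 a.2.
rewrite (gryz _ _ a b cs1) -(iryz _ _ a a cs1) -(iryz _ _ a b cs1) -(iryz _ _ b b cs1).
have : (ryz c1 s1 a).2 = 0%R by [].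
move: (ryz c1 s1 a) (ryz c1 s1 b) => {z1}a {}b a2.
have [c2 [s2 [cs2 z2 p2]]] := exists_rotation_to_axis a.1.1 a.1.2.
rewrite (grxy _ _ a b cs2) -(irxy _ _ a a cs2) -(irxy _ _ a b cs2) -(irxy _ _ b b cs2).
have : (rxy c2 s2 a).1.2 = 0%R by [].
have : (rxy c2 s2 a).2 = 0%R by [].
have : (0 <= (rxy c2 s2 a).1.1)%R by [].
move: (rxy c2 s2 a) (rxy c2 s2 b) => {z2 p2 a2}a {}b a0 a2 a1.
(* This last rotation turns about the first axis, so it fixes [a] while clearing the third
   coordinate of [b]. *)
have [c3 [s3 [cs3 z3 p3]]] := exists_rotation_to_axis b.1.2 b.2.
rewrite (gryz _ _ a b cs3) -(iryz _ _ a a cs3) -(iryz _ _ a b cs3) -(iryz _ _ b b cs3).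
have -> : ryz c3 s3 a = (a.1.1, 0, 0)%R.
  by rewrite /ryz a1 a2 !mulr0 addr0 subr0.
have : (ryz c3 s3 b).2 = 0%R by [].
have : (0 <= (ryz c3 s3 b).1.2)%R by [].
move: (ryz c3 s3 b) => {z3 p3}b b1 b2.
pose h (z : R * R) := psi (a.1.1 * z.1, b.1.1 * z.1 + b.1.2 * z.2)%R.
have mh : measurable_fun setT h.
  apply: measurableT_comp => //; apply: measurable_fun_pair.
    exact: measurable_funM.
  by apply: measurable_funD; apply: measurable_funM.
exists a.1.1, b.1.1, b.1.2; split; [exact: a0|exact: b1| | |split].
- by rewrite /lin3 /=; ring.
- by rewrite /lin3 /=; ring.
- by rewrite /lin3 /= b2; ring.
transitivity (gauss3 (h \o fst)); last exact: (gauss3E mh (fun=> psi0 _)).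
by congr gauss3; apply/funext => z; rewrite /h /lin3 /= b2; congr psi; congr pair; ring.
Qed.

End GaussianSpace.

(** * Gaussian wedges and their slope *)

Section Wedge.
Import numFieldNormedType.Exports.
Variable R : realType.
Local Notation mu := (@lebesgue_measure R).
Local Notation phi := (@normal_pdf R 0 1).
Local Open Scope classical_set_scope.
Local Open Scope ring_scope.
Local Open Scope ereal_scope.

Lemma normal_pdf01E (x : R) : phi x = (normal_peak 1 * expR (- (x ^+ 2) / 2))%R.
Proof. by rewrite normal_pdfE ?oner_neq0// /normal_fun subr0 expr1n. Qed.

(** The square is [1 / (2 pi)], and the crude bound [pi >= 2] suffices. This is the source of the
    Lipschitz constant [1 / 4] of [wedge]. *)
Lemma normal_peak1_sqr_le : ((normal_peak 1) ^+ 2 <= 1 / 4 :> R)%R.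
Proof.
have p2 := pi_ge2 R.
rewrite /normal_peak expr1n mul1r exprVn sqr_sqrtr; last by rewrite mulrn_wge0 ?pi_ge0.
rewrite mulr2n div1r lef_pV2 ?posrE; lra.
Qed.

Lemma is_derive_normal_pdf01 (x : R) : is_derive x (1 : R)%R phi (- (x * phi x))%R.
Proof.
have -> : phi = (fun x => normal_peak 1 * expR (- (x ^+ 2) / 2))%R.
  by apply/funext => y; rewrite normal_pdf01E.
have h : is_derive x (1 : R)%R (fun x : R => - (x ^+ 2) / 2)%R (- x)%R.
  by apply: is_derive_eq; rewrite /GRing.scale/=; field.
apply: is_derive_eq; rewrite /GRing.scale/=; ring.
Qed.

Lemma cvg_normal_pdf01 : phi x @[x --> +oo%R] --> (0 : R)%R.
Proof.
have -> : phi = (fun x => normal_peak 1 * expR (- ((x ^+ 2) / 2)))%R.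
  by apply/funext => y; rewrite normal_pdf01E mulNr.
rewrite -[X in _ --> X](mulr0 (normal_peak 1)); apply: cvgMl_tmp.
apply: (cvg_comp (fun x : R => x ^+ 2 / 2)%R (fun x => expR (- x)%R)); last exact: cvgr_expR.
apply: gt0_cvgMly; first by rewrite invr_gt0.
exact: cvgr_expr2.
Qed.

(** [- phi] is an antiderivative of the integrand and vanishes at infinity. *)
Lemma integral_id_normal_pdf :
  \int[mu]_(x in `[0%R, +oo[) (x * phi x)%:E = (normal_peak 1)%:E.
Proof.
rewrite (@ge0_continuous_FTC2y _ _ (fun x => - phi x)%R 0%R 0%R).
- by rewrite -EFinB sub0r opprK normal_pdf01E expr0n/= oppr0 mul0r expR0 mulr1.
- by move=> x x0; rewrite mulr_ge0 ?normal_pdf_ge0.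
- apply: continuous_subspaceT => x.
  apply: cvgM; first exact: cvg_id.
  exact/continuous_normal_pdf/oner_neq0.
- rewrite -[X in _ --> X]oppr0; exact: (@cvgN _ R^o _ _ _ _ _ cvg_normal_pdf01).
- move=> x _; have := is_derive_normal_pdf01 x => h.
  by apply: derivableN; exact: ex_derive.
- apply: cvg_at_right_filter; apply: (@cvgN _ R^o).
  exact/continuous_normal_pdf/oner_neq0.
- move=> x _; rewrite derive1E.
  have h := is_derive_normal_pdf01 x.
  by rewrite (@derive_val _ _ _ _ _ _ _ (is_deriveN h)) opprK.
Qed.

Lemma measurable_gauss2 (h : R * R -> R) : measurable_fun setT h ->
  measurable_fun setT (fun z : R * R => (phi z.1 * phi z.2 * h z)%:E).
Proof.
move=> mh; apply/measurable_EFinP; apply: measurable_funM => //.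
apply: measurable_funM; exact: (measurableT_comp (measurable_normal_pdf 0 1)).
Qed.

Lemma gauss2E (h : R * R -> R) : measurable_fun setT h -> (forall z, (0 <= h z)%R) ->
  gauss2 h = \int[mu \x mu]_z (phi z.1 * phi z.2 * h z)%:E.
Proof.
move=> mh h0; apply/esym.
apply: (@fubini_tonelli1 _ _ _ _ R mu mu (fun z : R * R => (phi z.1 * phi z.2 * h z)%:E)).
  exact: measurable_gauss2.
by move=> z; rewrite lee_fin !mulr_ge0 ?normal_pdf_ge0.
Qed.

Lemma gauss2_sum (I : finType) (h : I -> R * R -> R) :
  (forall i, measurable_fun setT (h i)) -> (forall i z, (0 <= h i z)%R) ->
  gauss2 (fun z => \sum_i h i z)%R = \sum_i gauss2 (h i).
Proof.
move=> mh h0; rewrite gauss2E; last 2 first.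
- exact: measurable_sum.
- by move=> z; rewrite sumr_ge0.
transitivity (\int[mu \x mu]_z \sum_i (phi z.1 * phi z.2 * h i z)%:E).
  by apply: eq_integral => z _; rewrite sumEFin mulr_sumr.
rewrite ge0_integral_sum//; last 2 first.
- by move=> i; exact: measurable_gauss2.
- by move=> i z _; rewrite lee_fin !mulr_ge0 ?normal_pdf_ge0.
by apply: eq_bigr => i _; rewrite gauss2E.
Qed.

(** Squared area of the parallelogram spanned by [a] and [b]; it is positive exactly when they are
    linearly independent. *)
Definition gram2 (a b : R * R * R) : R :=
  (lin3 a a * lin3 b b - lin3 a b ^+ 2)%R.

(** For independent [a] and [b], the coefficients provided by [gauss3_lin3] are those of
    Gram-Schmidt orthogonalization, hence explicit in the inner products. *)
Lemma gauss3_lin3_gram (psi : R * R -> R) (a b : R * R * R) :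
  measurable_fun setT psi -> (forall z, (0 <= psi z)%R) -> (0 < gram2 a b)%R ->
  let alpha := Num.sqrt (lin3 a a) in
  [/\ (0 < alpha)%R, (0 < Num.sqrt (gram2 a b) / alpha)%R &
  gauss3 (fun z => psi (lin3 a z, lin3 b z)) =
  gauss2 (fun z => psi (alpha * z.1,
    lin3 a b / alpha * z.1 + Num.sqrt (gram2 a b) / alpha * z.2)%R)].
Proof.
move=> mpsi psi0 K0 alpha.
have [al [be [ga [al0 ga0 aa ab [bb ->]]]]] := gauss3_lin3 a b mpsi psi0.
have -> : alpha = al by rewrite /alpha -aa sqrtr_sqr ger0_norm.
move: K0; rewrite /gram2 -aa -ab -bb.
have -> : (al ^+ 2 * (be ^+ 2 + ga ^+ 2) - (al * be) ^+ 2 = (al * ga) ^+ 2)%R by ring.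
rewrite sqrtr_sqr (ger0_norm (mulr_ge0 al0 ga0)) => K0.
have agn0 : (al * ga != 0)%R by apply: contraTneq K0 => ->; rewrite expr0n ltxx.
have aln0 : al != 0%R by apply: contraNneq agn0 => ->; rewrite mul0r.
have gan0 : ga != 0%R by apply: contraNneq agn0 => ->; rewrite mulr0.
have -> : (al * be / al = be)%R by field.
have -> : (al * ga / al = ga)%R by field.
by split=> //; rewrite lt0r ?aln0 ?gan0.
Qed.

Definition wedge_ind (z : R * R) : R :=
  if (0 < z.1)%R && (0 < z.2)%R then 1%R else 0%R.

Lemma wedge_ind_ge0 z : (0 <= wedge_ind z)%R.
Proof. by rewrite /wedge_ind; case: ifP. Qed.

Lemma measurable_wedge_ind : measurable_fun setT wedge_ind.
Proof.
apply: measurable_fun_ifT => //; apply: measurable_and => //;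
  exact: measurable_fun_ltr.
Qed.

(** Gaussian mass of the part of the right half-plane above the line through the origin of slope
    [- m]. *)
Definition wedge (m : R) : \bar R :=
  gauss2 (fun z => wedge_ind (z.1, m * z.1 + z.2)%R).

(** Only the signs of the two forms matter, so each may be divided by a positive constant; a single
    ratio of coefficients survives. *)
Lemma gauss3_wedge (a b : R * R * R) : (0 < gram2 a b)%R ->
  gauss3 (fun z => wedge_ind (lin3 a z, lin3 b z)) =
  wedge (lin3 a b / Num.sqrt (gram2 a b)).
Proof.
move=> K0; have [a0 g0 ->] := gauss3_lin3_gram measurable_wedge_ind wedge_ind_ge0 K0.
congr gauss2; apply/funext => z; rewrite /wedge_ind /= pmulr_rgt0//.
set al := Num.sqrt (lin3 a a); set k := Num.sqrt (gram2 a b).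
have k0 : (0 < k)%R by rewrite sqrtr_gt0.
have an0 : al != 0%R by rewrite gt_eqF.
have kn0 : k != 0%R by rewrite gt_eqF.
rewrite (_ : _ + _ = (k / al) * (lin3 a b / k * z.1 + z.2))%R; last by field; rewrite an0 kn0.
by rewrite pmulr_rgt0.
Qed.

Lemma measurable_wedge_integrand (m : R) :
  measurable_fun setT (fun z : R * R => wedge_ind (z.1, m * z.1 + z.2)%R).
Proof.
apply: (measurableT_comp measurable_wedge_ind); apply: measurable_fun_pair => //.
by apply: measurable_funD => //; apply: measurable_funM.
Qed.

End Wedge.

(** * Negligibility of ties and the Lipschitz bound for wedges *)

Section WedgeLipschitz.
Variable R : realType.
Local Notation mu := (@lebesgue_measure R).
Local Notation phi := (@normal_pdf R 0 1).
Local Open Scope classical_set_scope.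
Local Open Scope ring_scope.
Local Open Scope ereal_scope.

(** The three excluded lines are null: for [x] nonzero, the vertical line at [x] meets them only at
    the heights [y1] and [y2]. *)
Lemma gauss2_no_ties (psi : R * R -> R) (al be ga : R) : al != 0%R -> ga != 0%R ->
  measurable_fun setT psi -> (forall z, (0 <= psi z)%R) ->
  (forall u v, u != 0 -> v != 0 -> u + v != 0 -> psi (u, v) = 1)%R ->
  gauss2 (fun z => psi (al * z.1, be * z.1 + ga * z.2)%R) = 1.
Proof.
move=> al0 ga0 mpsi psi0 psi1.
pose h (z : R * R) := psi (al * z.1, be * z.1 + ga * z.2)%R.
have mh : measurable_fun setT h.
  apply: measurableT_comp => //; apply: measurable_fun_pair.
    exact: measurable_funM.
  by apply: measurable_funD; apply: measurable_funM.
pose f (z : R * R) := (phi z.1 * phi z.2 * h z)%:E.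
have mf : measurable_fun setT f by exact: measurable_gauss2.
have f0 z : 0 <= f z by rewrite lee_fin !mulr_ge0 ?normal_pdf_ge0 ?psi0.
rewrite -[RHS](@integral_normal_pdf R 0 1).
apply: ae_eq_integral => //.
- exact: (@measurable_fun_fubini_tonelli_F _ _ _ _ R mu f mf f0).
- by apply/measurable_EFinP; exact: measurable_normal_pdf.
exists [set 0%R]; split => //=; first exact: lebesgue_measure_set1.
move=> x /=; apply: contra_notP => /eqP x0 _.
transitivity (\int[mu]_y ((phi x)%:E * (phi y)%:E)); last first.
  rewrite ge0_integralZl//= ?lee_fin ?normal_pdf_ge0//.
  - by rewrite integral_normal_pdf mule1.
  - by apply/measurable_EFinP; exact: measurable_normal_pdf.
  - by move=> y _; rewrite lee_fin normal_pdf_ge0.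
have mfx : measurable_fun setT (fun y => f (x, y)) by exact: measurableT_comp.
apply: (@ae_eq_integral _ _ R mu setT _ (fun y => f (x, y))) => //.
- apply: emeasurable_funM => //.
  by apply/measurable_EFinP; exact: measurable_normal_pdf.
pose y1 := (- (be * x) / ga)%R; pose y2 := (- ((al + be) * x) / ga)%R.
exists ([set y1] `|` [set y2]); split => /=.
- exact: measurableU.
- apply/eqP; rewrite eq_le measure_ge0 andbT.
  apply: (le_trans (measureU2 _ _ _)) => //=.
  by rewrite (lebesgue_measure_set1 y1) (lebesgue_measure_set1 y2) adde0.
move=> y /=; apply: contra_notP => /not_orP[/eqP ny1 /eqP ny2] _.
rewrite /f /h /= psi1 ?mulr1//=.
- by rewrite mulf_neq0.
- apply: contraNneq ny1 => e; rewrite /y1.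
  by apply/eqP; apply: (mulfI ga0); rewrite mulrCA divff// mulr1; lra.
- apply: contraNneq ny2 => e; rewrite /y2.
  by apply/eqP; apply: (mulfI ga0); rewrite mulrCA divff// mulr1; lra.
Qed.

Lemma gauss2_1 : gauss2 (cst 1%R) = 1 :> \bar R.
Proof. by apply: (@gauss2_no_ties (cst 1%R) 1 0 1) => //; rewrite oner_neq0. Qed.

Lemma gauss2_ge0 (h : R * R -> R) : (forall z, (0 <= h z)%R) -> 0 <= gauss2 h.
Proof.
move=> h0; apply: integral_ge0 => x _; apply: integral_ge0 => y _.
by rewrite lee_fin !mulr_ge0 ?normal_pdf_ge0.
Qed.

Lemma le_gauss2 (h g : R * R -> R) : measurable_fun setT h ->
  measurable_fun setT g -> (forall z, (0 <= h z <= g z)%R) -> gauss2 h <= gauss2 g.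
Proof.
move=> mh mg hg.
have h0 z : (0 <= h z)%R by have /andP[] := hg z.
have g0 z : (0 <= g z)%R by have /andP[/le_trans] := hg z; apply.
rewrite !gauss2E//; apply: ge0_le_integral => //.
- by move=> z _; rewrite lee_fin !mulr_ge0 ?normal_pdf_ge0.
- exact: measurable_gauss2.
- exact: measurable_gauss2.
- move=> z _; rewrite lee_fin ler_wpM2l ?mulr_ge0 ?normal_pdf_ge0//.
  by have /andP[] := hg z.
Qed.

Lemma gauss2D (h g : R * R -> R) : measurable_fun setT h ->
  measurable_fun setT g -> (forall z, (0 <= h z)%R) -> (forall z, (0 <= g z)%R) ->
  gauss2 (fun z => h z + g z)%R = gauss2 h + gauss2 g.
Proof.
move=> mh mg h0 g0.
rewrite !gauss2E//; last 2 first.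
- exact: measurable_funD.
- by move=> z; rewrite addr_ge0.
under eq_integral do rewrite mulrDr EFinD.
rewrite ge0_integralD//.
- by move=> z _; rewrite lee_fin !mulr_ge0 ?normal_pdf_ge0.
- exact: measurable_gauss2.
- by move=> z _; rewrite lee_fin !mulr_ge0 ?normal_pdf_ge0.
- exact: measurable_gauss2.
Qed.

Lemma gauss2_fin_num (h : R * R -> R) : measurable_fun setT h ->
  (forall z, (0 <= h z <= 1)%R) -> gauss2 h \is a fin_num.
Proof.
move=> mh h01; rewrite ge0_fin_numE; last first.
  by apply: gauss2_ge0 => z; have /andP[] := h01 z.
apply: (@le_lt_trans _ _ 1); last exact: ltry.
by rewrite -gauss2_1; apply: le_gauss2.
Qed.

Lemma wedge_fin_num (m : R) : wedge m \is a fin_num.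
Proof.
apply: gauss2_fin_num; first exact: measurable_wedge_integrand.
by move=> z; rewrite /wedge_ind; case: ifP; rewrite ?ler01 ?lexx.
Qed.

(** For [m' <= m], the indicator of the wedge of [m] minus that of the wedge of [m']. *)
Let strip (m m' : R) (z : R * R) : R :=
  if (0 < z.1)%R && ((- (m * z.1) < z.2)%R && (z.2 <= - (m' * z.1))%R)
  then 1%R else 0%R.

Let strip_ge0 m m' z : (0 <= strip m m' z)%R.
Proof. by rewrite /strip; case: ifP. Qed.

Let measurable_strip m m' : measurable_fun setT (strip m m').
Proof.
apply: measurable_fun_ifT => //; apply: measurable_and; last apply: measurable_and.
- exact: measurable_fun_ltr.
- by apply: measurable_fun_ltr => //; apply: measurableT_comp => //; apply: measurable_funM.
- by apply: measurable_fun_ler => //; apply: measurableT_comp => //; apply: measurable_funM.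
Qed.

(** The slice at [x > 0] has length [(m - m') * x], and the density in [y] is at most its peak.
    Integrating [x * phi x] gives a second factor [normal_peak 1], and the square of the peak is at
    most [1 / 4]. *)
Let gauss2_strip (m m' : R) : (m' <= m)%R ->
  gauss2 (strip m m') <= ((m - m') / 4)%:E.
Proof.
move=> m'm; pose f (z : R * R) := (phi z.1 * phi z.2 * strip m m' z)%:E.
have mf : measurable_fun setT f by exact: measurable_gauss2.
have f0 z : 0 <= f z by rewrite lee_fin !mulr_ge0 ?normal_pdf_ge0.
pose k : R := (normal_peak 1 * (m - m'))%R.
have k0 : (0 <= k)%R by rewrite mulr_ge0 ?normal_peak_ge0// subr_ge0.
have pk : (k * normal_peak 1 <= (m - m') / 4)%R.
  have := @normal_peak1_sqr_le R => p4.
  rewrite /k mulrAC -expr2 mulrC ler_wpM2l// ?subr_ge0//; lra.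
apply: (@le_trans _ _ (k * normal_peak 1)%:E); last by rewrite lee_fin.
have mid : measurable_fun setT (fun x : R => (x * phi x)%:E).
  apply/measurable_EFinP; apply: measurable_funM => //; exact: measurable_normal_pdf.
rewrite EFinM -integral_id_normal_pdf -ge0_integralZl//=; last 2 first.
- exact: measurable_funS mid.
- by move=> x; rewrite in_itv/= andbT => x0; rewrite lee_fin mulr_ge0 ?normal_pdf_ge0.
rewrite [leRHS]integral_mkcond; apply: ge0_le_integral => //.
- by move=> x _; apply: integral_ge0 => y _; exact: (f0 (x, y)).
- exact: (@measurable_fun_fubini_tonelli_F _ _ _ _ R mu f mf f0).
- apply/(measurable_restrictT _ _).1 => //; apply: emeasurable_funM => //.
  exact: measurable_funS mid.
move=> x _; rewrite patchE mem_setE in_itv/= andbT.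
have [x0|x0] := leP 0%R x; last first.
  rewrite integral0_eq// => y _; rewrite /strip /=.
  by rewrite ltNge (ltW x0) /= mulr0.
pose A : set R := `](- (m * x))%R, (- (m' * x))%R]%classic.
have mA : measurable A by exact: measurable_itv.
apply: (@le_trans _ _ (\int[mu]_y ((phi x * normal_peak 1)%:E * (\1_A y)%:E))).
  have mfx : measurable_fun setT (fun y => f (x, y)) by exact: measurableT_comp.
  apply: (@ge0_le_integral _ _ R mu setT _ (fun y => f (x, y))) => //.
  - apply: emeasurable_funM => //; apply/measurable_EFinP; exact: measurable_indic.
  move=> y _; rewrite -EFinM lee_fin -mulrA -[leRHS]mulrA.
  rewrite ler_wpM2l ?normal_pdf_ge0// ler_pM ?normal_pdf_ge0//.
    by rewrite normal_pdf_ub ?oner_neq0.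
  rewrite /strip indicE mem_setE in_itv /=.
  by case: (_ && (_ <= _)%R); rewrite ?andbF//; case: ifP.
have mi : measurable_fun setT (fun y => (\1_A y : R)%:E).
  by apply/measurable_EFinP; exact: measurable_indic.
rewrite ge0_integralZl//=; last first.
- by rewrite lee_fin mulr_ge0 ?normal_pdf_ge0 ?normal_peak_ge0.
rewrite integral_indic// setIT.
rewrite [X in _ * X <= _](_ : _ = if (- (m * x) < - (m' * x))%R
    then (- (m' * x) - - (m * x))%:E else 0); last first.
  by rewrite [LHS]lebesgue_measure_itv/= lte_fin EFinB.
case: ifP => _; last first.
  by rewrite mule0 -EFinM lee_fin (mulr_ge0 k0)// mulr_ge0 ?normal_pdf_ge0.
rewrite -!EFinM lee_fin /k le_eqVlt; apply/orP; left; apply/eqP; ring.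
Qed.

(** The smaller wedge lies in the larger one, which is covered by the smaller one and the strip. *)
Lemma wedge_lipschitz (m m' : R) :
  (`|fine (wedge m) - fine (wedge m')| <= `|m - m'| / 4)%R.
Proof.
wlog m'm : m m' / (m' <= m)%R => [hw|].
  have [m'm|/ltW mm'] := leP m' m; first exact: (hw m m' m'm).
  by have h := hw m' m mm'; rewrite distrC (distrC m).
pose h m (z : R * R) := wedge_ind (z.1, m * z.1 + z.2)%R.
have mh n : measurable_fun setT (h n) := measurable_wedge_integrand n.
have h0 n z : (0 <= h n z)%R := wedge_ind_ge0 _.
have l1 : wedge m' <= wedge m.
  apply: le_gauss2; [exact: mh|exact: mh|] => z; rewrite wedge_ind_ge0 /wedge_ind /=.
  have [z0|z0] := ltP 0%R z.1 => //=.
  have : (m' * z.1 <= m * z.1)%R by rewrite ler_pM2r.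
  by case: ifP => [z1|_ _]; case: ifP => //; lra.
have l2 : wedge m <= wedge m' + ((m - m') / 4)%:E.
  apply: (@le_trans _ _ (wedge m' + gauss2 (strip m m'))); last first.
    by rewrite leeD2l// gauss2_strip.
  rewrite -[X in _ <= X](gauss2D (mh m') (measurable_strip m m') (h0 m') (strip_ge0 m m')).
  apply: le_gauss2; [exact: mh|exact: measurable_funD|] => z.
  rewrite h0 /h /strip /wedge_ind /=.
  have [z0|z0] := ltP 0%R z.1; rewrite /= ?addr0//.
  have [|z1] := ltP 0%R (m * z.1 + z.2)%R; last by case: ifP; case: ifP => _ _; lra.
  have [|z2 z1] := ltP 0%R (m' * z.1 + z.2)%R; first by case: ifP => _ _ _; lra.
  by rewrite ifT ?add0r//; apply/andP; split; lra.
have fm := wedge_fin_num m; have fm' := wedge_fin_num m'.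
move: (wedge m) (wedge m') fm fm' l1 l2 => [u| |]// [v| |]// _ _.
rewrite -EFinD !lee_fin /= => l1 l2.
by rewrite !ger0_norm ?subr_ge0//; lra.
Qed.

End WedgeLipschitz.

(** * Ordering probabilities as wedge masses *)

Section Orderings.
Variable R : realType.

(** The six listed permutations are told apart by their images [code]; since the group has order
    [3!], the list is complete. *)
Lemma sum_perm3 (f : 'I_3 -> 'I_3 -> 'I_3 -> R) :
  \sum_(s : 'S_3) f (s 0) (s 1) (s 2) =
  f 0 1 2 + f 0 2 1 + f 1 0 2 + f 1 2 0 + f 2 0 1 + f 2 1 0.
Proof.
pose i0 : 'I_3 := 0; pose i1 : 'I_3 := 1; pose i2 : 'I_3 := 2.
pose p : seq 'S_3 := [:: 1%g; tperm i1 i2; tperm i0 i1;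
  (tperm i1 i2 * tperm i0 i1)%g; (tperm i0 i1 * tperm i1 i2)%g; tperm i0 i2].
pose code (s : 'S_3) := (s 0, s 1, s 2).
have cq : map code p =
    [:: (0, 1, 2); (0, 2, 1); (1, 0, 2); (1, 2, 0); (2, 0, 1); (2, 1, 0)].
  by apply/eqP; rewrite /p /code /= !permM !perm1 !permE /=.
have up : uniq p by apply: (@map_uniq _ _ code); rewrite cq.
have pe : perm_eq (index_enum 'S_3) p.
  apply: uniq_perm => //; first exact: index_enum_uniq.
  have sz : (size (index_enum 'S_3) <= size p)%N.
    rewrite -[size p]/(3`!)%N -card_Sn cardE; apply: uniq_leq_size.
      exact: index_enum_uniq.
    by move=> s _; rewrite mem_enum.
  have [|_ e] := uniq_min_size up _ sz; first by move=> s _; rewrite mem_index_enum.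
  by move=> s; rewrite e.
rewrite (perm_big _ pe) /=.
transitivity (\sum_(c <- map code p) f c.1.1 c.1.2 c.2); first by rewrite big_map.
by rewrite cq !big_cons big_nil /= addr0 !addrA.
Qed.
Lemma sum_ord3 (F : 'I_3 -> R) : \sum_k F k = F 0 + F 1 + F 2.
Proof.
rewrite !big_ord_recl big_ord0 addr0 addrA.
by congr (F _ + F _ + F _); apply/val_inj.
Qed.

Definition row3 (B : 'M[R]_3) (i : 'I_3) : R * R * R := (B i 0, B i 1, B i 2).

Lemma mulmx_tr3 (B : 'M[R]_3) i j :
  (B *m B^T) i j = lin3 (row3 B i) (row3 B j).
Proof. by rewrite mxE sum_ord3 !mxE. Qed.

Definition sub3v (a b : R * R * R) : R * R * R :=
  (a.1.1 - b.1.1, a.1.2 - b.1.2, a.2 - b.2).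

Lemma lin3Bl a b z : lin3 (sub3v a b) z = lin3 a z - lin3 b z.
Proof. by rewrite /lin3 /=; ring. Qed.

Lemma lin3C a b : lin3 a b = lin3 b a :> R.
Proof. by rewrite /lin3; ring. Qed.

(* Slope [c / sqrt K] of the wedge [{a . z > 0, b . z > 0}], where [c] is the
   inner product and [K] the Gram determinant of [a] and [b], in terms of
   [d1 = |a|^2], [d2 = |b|^2] and [d3 = |a + b|^2]. *)
Definition gram_of (d1 d2 d3 : R) : R := d1 * d2 - ((d3 - d1 - d2) / 2) ^+ 2.
Definition slope (d1 d2 d3 : R) : R :=
  (d3 - d1 - d2) / 2 / Num.sqrt (gram_of d1 d2 d3).

(** Variance of the difference of coordinates [i] and [j]; also the squared distance between rows
    [i] and [j] of any [B] with [B *m B^T = S]. *)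
Definition sqdist (k : nat) (S : 'M[R]_k) (i j : 'I_k) : R :=
  S i i + S j j - S i j - S j i.

Section Ordprob.
Variables (n : nat) (S : 'M[R]_n) (t : Trip n).
Hypothesis exB : exists B : 'M[R]_3, B *m B^T = sub3 t S.
Let d (i j : 'I_3) := sqdist S (tnth (trip_idx t) i) (tnth (trip_idx t) j).

(** Exposes the square root chosen inside [ordprob]. By polarization, inner products of differences
    of its rows depend only on the distances [d], so the choice is immaterial. *)
Let ordprob_gauss3 : exists B : 'M[R]_3, [/\ B *m B^T = sub3 t S,
  (forall s : 'S_3, ordprob 0 S t s =
    fine (gauss3 (fun z => if ordered3 (\col_i lin3 (row3 B i) z) s then 1 else 0)))
  & forall i j k l, lin3 (sub3v (row3 B i) (row3 B j)) (sub3v (row3 B k) (row3 B l)) =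
     (d i l + d j k - d i k - d j l) / 2].
Proof.
rewrite /ordprob; case: pselect => // ex; case: cid => B /= BE.
exists B; split; [exact: BE| |].
- move=> s'; apply: (congr1 (@fine R)).
  apply: eq_integral => z0 _; apply: eq_integral => z1 _; apply: eq_integral => z2 _.
  rewrite (_ : _ + _ = \col_i lin3 (row3 B i) (z0, z1, z2)) //.
  apply/matrixP => i j; rewrite (ord1 j) !mxE add0r sum_ord3 !mxE.
  by rewrite /lin3 /row3.
- move=> i j k l.
  have e a b : S (tnth (trip_idx t) a) (tnth (trip_idx t) b) = lin3 (row3 B a) (row3 B b).
    by rewrite -mulmx_tr3 BE mxE.
  have dE a b : d a b = lin3 (row3 B a) (row3 B a) + lin3 (row3 B b) (row3 B b)
      - lin3 (row3 B a) (row3 B b) *+ 2.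
    by rewrite /d /sqdist !e [lin3 (row3 B b) (row3 B a)]lin3C; ring.
  rewrite !dE lin3Bl [lin3 (row3 B i) (sub3v _ _)]lin3C.
  rewrite [lin3 (row3 B j) (sub3v _ _)]lin3C !lin3Bl.
  rewrite [lin3 (row3 B k) (row3 B i)]lin3C [lin3 (row3 B l) (row3 B i)]lin3C.
  rewrite [lin3 (row3 B k) (row3 B j)]lin3C [lin3 (row3 B l) (row3 B j)]lin3C.
  by field.
Qed.

Let d_sym i j : d i j = d j i.
Proof. by rewrite /d /sqdist; ring. Qed.

Let d_id i : d i i = 0.
Proof. by rewrite /d /sqdist; ring. Qed.

(** The ordering [s] holds when the two successive differences, with coefficients [a] and [b], are
    positive. The difference of the extreme alternatives is [a + b], which supplies the third
    distance. *)
Lemma ordprob_slope (s : 'S_3) :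
  0 < gram_of (d (s 0) (s 1)) (d (s 1) (s 2)) (d (s 0) (s 2)) ->
  ordprob 0 S t s =
  fine (wedge (slope (d (s 0) (s 1)) (d (s 1) (s 2)) (d (s 0) (s 2)))).
Proof.
have [B [_ -> dE]] := ordprob_gauss3.
set a := sub3v (row3 B (s 0)) (row3 B (s 1)).
set b := sub3v (row3 B (s 1)) (row3 B (s 2)).
have aa : lin3 a a = d (s 0) (s 1).
  by rewrite dE !d_id [d (s 1) (s 0)]d_sym; field.
have bb : lin3 b b = d (s 1) (s 2).
  by rewrite dE !d_id [d (s 2) (s 1)]d_sym; field.
have ab : lin3 a b = (d (s 0) (s 2) - d (s 0) (s 1) - d (s 1) (s 2)) / 2.
  by rewrite dE d_id; field.
have gE : gram2 a b = gram_of (d (s 0) (s 1)) (d (s 1) (s 2)) (d (s 0) (s 2)).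
  by rewrite /gram2 aa bb ab.
rewrite -gE => g0; rewrite /slope -ab -gE -(gauss3_wedge g0).
apply: (congr1 (@fine R)); apply: (congr1 (@gauss3 R)); apply/funext => z.
by rewrite /wedge_ind /ordered3 !mxE /= !lin3Bl !subr_gt0.
Qed.

Lemma ordered3_unique (y : 'cV[R]_3) :
  y 0 0 != y 1 0 -> y 1 0 != y 2 0 -> y 0 0 != y 2 0 ->
  \sum_(s : 'S_3) (if ordered3 y s then 1 else 0) = 1 :> R.
Proof.
rewrite /ordered3.
rewrite (sum_perm3 (fun i j k => if (y j 0 < y i 0) && (y k 0 < y j 0) then 1 else 0)).
move: (y 0 0) (y 1 0) (y 2 0) => a b c.
case: (ltgtP a b) => //= ab; case: (ltgtP b c) => //= bc;
  case: (ltgtP a c) => //= ac _ _ _; rewrite ?addr0 ?add0r //; lra.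
Qed.

(** Here [z] holds the two successive differences; the coordinates are taken relative to the last
    one, which does not affect their order. *)
Let order_ind (s : 'S_3) (z : R * R) : R :=
  if ordered3 (\col_i [:: z.1 + z.2; z.2; 0]`_i) s then 1 else 0.

Let order_ind_ge0 s z : 0 <= order_ind s z. Proof. by rewrite /order_ind; case: ifP. Qed.

Let order_ind_le1 s z : order_ind s z <= 1. Proof. by rewrite /order_ind; case: ifP. Qed.

Let measurable_order_ind s : measurable_fun setT (order_ind s).
Proof.
have mi (i : 'I_3) : measurable_fun setT
    (fun z : R * R => (\col_(i < 3) [:: z.1 + z.2; z.2; 0]`_i) i (0 : 'I_1)).
  rewrite (_ : (fun _ => _) = fun z : R * R => [:: z.1 + z.2; z.2; 0]`_i); last first.
    by apply/funext => z; rewrite mxE.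
  case: i => -[|[|[|//]]] /= _.
  - exact: measurable_funD.
  - exact: measurable_snd.
  - exact: measurable_cst.
apply: measurable_fun_ifT => //; apply: measurable_and;
  apply: measurable_fun_ltr; exact: mi.
Qed.

(** Away from ties exactly one ordering occurs, and ties are negligible because the Gram determinant
    is positive. *)
Lemma ordprob_sum : 0 < gram_of (d 0 1) (d 1 2) (d 0 2) ->
  \sum_(s : 'S_3) ordprob 0 S t s = 1.
Proof.
have [B [_ pE dE]] := ordprob_gauss3.
set a := sub3v (row3 B 0) (row3 B 1).
set b := sub3v (row3 B 1) (row3 B 2).
have aa : lin3 a a = d 0 1 by rewrite dE !d_id [d 1 0]d_sym; field.
have bb : lin3 b b = d 1 2 by rewrite dE !d_id [d 2 1]d_sym; field.
have ab : lin3 a b = (d 0 2 - d 0 1 - d 1 2) / 2 by rewrite dE d_id; field.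
have gE : gram2 a b = gram_of (d 0 1) (d 1 2) (d 0 2).
  by rewrite /gram2 aa bb ab.
rewrite -gE => g0.
pose al := Num.sqrt (lin3 a a); pose be := lin3 a b / al.
pose ga := Num.sqrt (gram2 a b) / al.
have key s : ordprob 0 S t s =
    fine (gauss2 (fun z => order_ind s (al * z.1, be * z.1 + ga * z.2))).
  have [_ _ <-] := gauss3_lin3_gram (measurable_order_ind s) (order_ind_ge0 s) g0.
  rewrite pE; apply: (congr1 (@fine R)); apply: (congr1 (@gauss3 R)); apply/funext => z.
  rewrite /order_ind (_ : ordered3 _ _ = ordered3 (\col_i lin3 (row3 B i) z) s) //.
  have e (i : 'I_3) : [:: lin3 a z + lin3 b z; lin3 b z; 0]`_i =
      lin3 (row3 B i) z - lin3 (row3 B 2) z.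
    rewrite /a /b !lin3Bl; case: i => -[|[|[|]]]//= i3.
    - by rewrite (_ : Ordinal i3 = 0); [ring|exact/val_inj].
    - by rewrite (_ : Ordinal i3 = 1) //; exact/val_inj.
    - by rewrite (_ : Ordinal i3 = 2); [rewrite subrr|exact/val_inj].
  by rewrite /ordered3 !mxE /= !e !ltrD2r.
have [al0 ga0 _] := gauss3_lin3_gram (measurable_order_ind 1%g) (order_ind_ge0 1%g) g0.
have mt s : measurable_fun setT (fun z : R * R => order_ind s (al * z.1, be * z.1 + ga * z.2)).
  apply: (measurableT_comp (measurable_order_ind s)); apply: measurable_fun_pair.
    exact: measurable_funM.
  by apply: measurable_funD; apply: measurable_funM.
under eq_bigr do rewrite key.
rewrite sum_fine; last first.
  by move=> s _; apply: gauss2_fin_num => // z; rewrite order_ind_ge0 order_ind_le1.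
rewrite -gauss2_sum//.
rewrite (@gauss2_no_ties _ (fun z => \sum_s order_ind s z) al be ga) ?gt_eqF//.
- exact: measurable_sum.
- by move=> z; rewrite sumr_ge0.
move=> u v u0 v0 uv0; apply: ordered3_unique; rewrite !mxE //=.
by rewrite -subr_eq0 addrK.
Qed.

End Ordprob.

End Orderings.

(** * Square roots of positive semidefinite matrices *)

Section Cholesky.
Variable R : realType.

Lemma psd_block (k : nat) (a : R) (b : 'rV[R]_k) (S : 'M[R]_k) (t : R) (w : 'cV[R]_k) :
  ((col_mx t%:M w)^T *m block_mx a%:M b b^T S *m col_mx t%:M w) 0 0 =
  t ^+ 2 * a + 2 * t * (b *m w) 0 0 + (w^T *m S *m w) 0 0.
Proof.
rewrite tr_col_mx mul_row_block mul_row_col tr_scalar_mx.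
rewrite -scalar_mxM mul_scalar_mx mulmxDl !mulmxDl.
rewrite -scalar_mxM -[w^T *m b^T *m _]mulmxA.
rewrite (_ : w^T *m (b^T *m t%:M) = t *: (b *m w)); last first.
  by rewrite mul_mx_scalar -scalemxAr -trmx_mul; congr (_ *: _); apply/matrixP => i j; rewrite !ord1 mxE.
rewrite -scalemxAl !mxE eqxx /= mulr1n; ring.
Qed.

(** Cholesky factorization by induction on the size. A zero pivot forces its whole row to vanish;
    otherwise the Schur complement is again positive semidefinite. *)
Lemma psd_sqrt (k : nat) (S : 'M[R]_k) : S^T = S -> psd S ->
  exists B : 'M[R]_k, B *m B^T = S.
Proof.
elim: k S => [|k IH] S symS psdS; first by exists 0; apply/matrixP => -[].
pose a := S 0 0; pose b : 'rV[R]_k := ursubmx (S : 'M[R]_(1 + k)).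
pose D : 'M[R]_k := drsubmx (S : 'M[R]_(1 + k)).
have ES : S = block_mx a%:M b b^T D.
  have -> : a%:M = ulsubmx (S : 'M[R]_(1 + k)).
    apply/matrixP => i j; rewrite !ord1 !mxE eqxx mulr1n.
    by congr (S _ _); apply/val_inj.
  have -> : b^T = dlsubmx (S : 'M[R]_(1 + k)).
    by rewrite /b (trmx_ursub (S : 'M[R]_(1 + k))) symS.
  by rewrite submxK.
have symD : D^T = D by rewrite /D (trmx_drsub (S : 'M[R]_(1 + k))) symS.
clearbody a b D.
have q (t : R) (w : 'cV[R]_k) : 0 <= t ^+ 2 * a + 2 * t * (b *m w) 0 0 + (w^T *m D *m w) 0 0.
  by have := psdS (col_mx t%:M w); rewrite [in X in X -> _]ES psd_block.
have a0 : 0 <= a.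
  by have := q 1 0; rewrite !mulmx0 mxE; lra.
have bbT : (b *m b^T) 0 0 = \sum_i b 0 i ^+ 2.
  by rewrite mxE; apply: eq_bigr => i _; rewrite mxE expr2.
have [a00|an0] := eqVneq a 0.
  have b0 : b = 0.
    have bb0 : (b *m b^T) 0 0 = 0.
      set u := (b *m b^T) 0 0; set v := (b *m D *m b^T) 0 0.
      have u0 : 0 <= u by rewrite /u bbT sumr_ge0 // => i _; rewrite sqr_ge0.
      have h t : 0 <= 2 * t * u + v.
        by have := q t b^T; rewrite a00 trmxK mulr0 add0r.
      apply/eqP; case: (eqVneq u 0) => // un0.
      have up : 0 < u by rewrite lt0r un0.
      (* A nonconstant affine function of [t] cannot stay nonnegative: at this [t] it equals
         [-1]. *)
      have := h (- (v + 1) / (2 * u)).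
      rewrite (_ : 2 * _ * u + v = -1); last by field.
      by rewrite ler0N1.
    apply/matrixP => i j; rewrite ord1 [RHS]mxE; apply/eqP; rewrite -sqrf_eq0.
    move: bb0; rewrite bbT => /eqP; rewrite psumr_eq0; last by move=> ? _; rewrite sqr_ge0.
    by move=> /allP/(_ j (mem_index_enum _)).
  have [|B BE] := IH D symD.
    by move=> w; have := q 0 w; rewrite b0 mul0mx !mxE; lra.
  exists (block_mx 0 0 0 B : 'M[R]_(1 + k)).
  rewrite (@tr_block_mx _ 1 k 1 k) (@mulmx_block _ 1 k 1 k 1 k) !trmx0 !mul0mx !mulmx0 !addr0 add0r BE.
  by rewrite ES a00 b0 trmx0 raddf0.
have ap : 0 < a by rewrite lt0r an0.
pose r := Num.sqrt a.
have r2 : r * r = a by rewrite -expr2 sqr_sqrtr.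
have rn0 : r != 0 by rewrite gt_eqF // sqrtr_gt0.
have [| |B BE] := IH (D - a^-1 *: (b^T *m b)).
- by rewrite linearB linearZ /= trmx_mul trmxK symD.
(* This [t] minimizes the quadratic form for fixed [w]; the minimum is the form of the Schur
   complement. *)
- move=> w; have := q (- (b *m w) 0 0 / a) w.
  have -> : (w^T *m (D - a^-1 *: (b^T *m b)) *m w) 0 0 =
      (w^T *m D *m w) 0 0 - a^-1 * ((b *m w) 0 0 * (b *m w) 0 0).
    rewrite mulmxBr mulmxBl -scalemxAr -scalemxAl.
    have -> : w^T *m (b^T *m b) *m w = (b *m w)^T *m (b *m w).
      by rewrite trmx_mul !mulmxA.
    move: (b *m w) (w^T *m D *m w) => u v.
    by rewrite !mxE big_ord1 mxE.
  move: ((b *m w) 0 0) ((w^T *m D *m w) 0 0) => u v.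
  by rewrite (_ : _ + _ + _ = v - a^-1 * (u * u)); [|field].
exists (block_mx r%:M 0 (r^-1 *: b^T) B : 'M[R]_(1 + k)).
rewrite (@tr_block_mx _ 1 k 1 k) (@mulmx_block _ 1 k 1 k 1 k) !trmx0 !mul0mx !mulmx0 !addr0.
rewrite linearZ /= trmxK tr_scalar_mx -scalar_mxM r2 mul_scalar_mx mul_mx_scalar.
rewrite !scalerA divff // !scale1r -scalemxAl -scalemxAr scalerA BE -invfM r2.
by rewrite addrC subrK -ES.
Qed.

End Cholesky.

(** * The centered covariance: entries, trace and rank *)

Section PerturbedCovariance.
Variables (R : realType) (n : nat) (i j : 'I_n).

Definition ones_mx : 'M[R]_n := const_mx 1.

Definition centering_mx : 'M[R]_n := 1%:M - n%:R^-1 *: ones_mx.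

Definition corr_mx (x : R) : 'M[R]_n :=
  1%:M + x *: (delta_mx i j + delta_mx j i).

Definition centered_cov (x : R) : 'M[R]_n :=
  centering_mx *m corr_mx x *m centering_mx.

(* [n / \tr (centered_cov x)] is the factor normalizing the trace. *)
Definition perturbed_cov (x : R) : 'M[R]_n :=
  (n%:R / (n%:R - 1 - 2 * x / n%:R)) *: centered_cov x.

Hypothesis n_gt2 : (2 < n)%N.
Hypothesis ij : i != j.

Local Notation U := ones_mx.
Local Notation J := centering_mx.
Local Notation P := corr_mx.
Local Notation A := centered_cov.
Let nR_neq0 : n%:R != 0 :> R.
Proof. by rewrite pnatr_eq0 -lt0n (ltn_trans _ n_gt2). Qed.

(** Row sums of the perturbation [e_i e_j^T + e_j e_i^T]. *)
Let m (a : 'I_n) : R := (a == i)%:R + (a == j)%:R.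

Lemma corr_mxE x a b : P x a b =
  (a == b)%:R + x * (((a == i) && (b == j))%:R + ((a == j) && (b == i))%:R).
Proof. by rewrite !mxE. Qed.

Lemma corr_mx_sym x : (P x)^T = P x.
Proof.
apply/matrixP => a b; rewrite mxE !corr_mxE [b == a]eq_sym.
by rewrite [X in _ + x * X]addrC [(b == j) && _]andbC [(b == i) && _]andbC.
Qed.

Let sum_pick (a : 'I_n) (F : 'I_n -> R) : \sum_k (k == a)%:R * F k = F a.
Proof.
rewrite (bigD1 a)//= eqxx mul1r big1 ?addr0// => k /negbTE ->.
by rewrite mul0r.
Qed.

Let sum_pick1 (a : 'I_n) : \sum_(k < n) (k == a)%:R = 1 :> R.
Proof. by rewrite -[RHS](sum_pick a (fun=> 1)); apply: eq_bigr => k _; rewrite mulr1. Qed.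

Lemma corr_mx_col_sum x b : \sum_k P x k b = 1 + x * m b.
Proof.
under eq_bigr do rewrite corr_mxE.
rewrite big_split /= sum_pick1 -mulr_sumr big_split /=; congr (_ + _ * _).
rewrite /m addrC; congr (_ + _).
- under eq_bigr do rewrite -mulnb natrM.
  by rewrite (sum_pick j (fun=> (b == i)%:R)).
- under eq_bigr do rewrite -mulnb natrM.
  by rewrite (sum_pick i (fun=> (b == j)%:R)).
Qed.

Let sum_m x : \sum_a (1 + x * m a) = n%:R + 2 * x.
Proof.
rewrite big_split /= sumr_const card_ord -mulr_sumr big_split /= !sum_pick1.
ring.
Qed.

(** Double centering: the row mean and the column mean are subtracted and the grand mean is added
    back. *)
Lemma centered_covE x a b : A x a b =
  P x a b - (1 + x * m a) / n%:R - (1 + x * m b) / n%:R + (n%:R + 2 * x) / n%:R ^+ 2.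
Proof.
have UP c d : (U *m P x) c d = 1 + x * m d.
  rewrite mxE -corr_mx_col_sum; apply: eq_bigr => k _.
  by rewrite [U _ _]mxE mul1r.
have MU (M : 'M[R]_n) c d : (M *m U) c d = \sum_k M c k.
  by rewrite mxE; apply: eq_bigr => k _; rewrite [U _ _]mxE mulr1.
have -> : A x = P x - n%:R^-1 *: (U *m P x) - n%:R^-1 *: (P x *m U)
    + n%:R^-1 *: (n%:R^-1 *: (U *m P x *m U)).
  rewrite /A /J mulmxBl mul1mx mulmxBr mulmx1 -scalemxAl -scalemxAr mulmxBl -scalemxAl.
  by rewrite scalerBr opprB addrA addrAC.
have -> : forall M1 M2 M3 M4 : 'M[R]_n, (M1 - n%:R^-1 *: M2 - n%:R^-1 *: M3
    + n%:R^-1 *: (n%:R^-1 *: M4)) a b =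
    M1 a b - n%:R^-1 * M2 a b - n%:R^-1 * M3 a b + n%:R^-1 * (n%:R^-1 * M4 a b).
  by move=> *; rewrite !mxE.
rewrite UP !MU (eq_bigr _ (fun k _ => UP a k)) sum_m.
rewrite (eq_bigr (fun k => P x k a)); last by move=> k _; rewrite -{1}corr_mx_sym mxE.
by rewrite corr_mx_col_sum; field.
Qed.

Lemma centering_mx_sym : J^T = J.
Proof. by rewrite /J linearB linearZ /= tr_scalar_mx trmx_const. Qed.

Lemma centering_mx_ones : J *m (const_mx 1 : 'cV[R]_n) = 0.
Proof.
rewrite mulmxBl mul1mx -scalemxAl.
apply/matrixP => a b; rewrite !mxE.
rewrite (eq_bigr (fun=> 1)); last by move=> k _; rewrite !mxE mulr1.
by rewrite sumr_const card_ord mulVf// subrr.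
Qed.

Lemma centered_cov_sym x : (A x)^T = A x.
Proof. by rewrite /A !trmx_mul centering_mx_sym corr_mx_sym mulmxA. Qed.

(** The quadratic form is [|w|^2 + 2 x w_i w_j], and [2 w_i w_j >= - (w_i^2 + w_j^2) >= - |w|^2]. *)
Lemma corr_mx_coercive x (w : 'cV[R]_n) : 0 <= x ->
  (1 - x) * (\sum_k w k 0 ^+ 2) <= (w^T *m P x *m w) 0 0.
Proof.
move=> x0.
have -> : (w^T *m P x *m w) 0 0 = \sum_k w k 0 ^+ 2 + 2 * x * (w i 0 * w j 0).
  have -> : w^T *m P x *m w = w^T *m w + x *: (w^T *m delta_mx i j *m w)
      + x *: (w^T *m delta_mx j i *m w).
    rewrite /P mulmxDr mulmx1 mulmxDl -scalemxAr -scalemxAl mulmxDr mulmxDl.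
    by rewrite scalerDr addrA.
  have dl (a b : 'I_n) : (w^T *m delta_mx a b *m w) 0 0 = w a 0 * w b 0.
    rewrite mxE (bigD1 b)//= big1 ?addr0.
      rewrite mxE (bigD1 a)//= big1 ?addr0 ?mxE ?eqxx ?mulr1//.
      by move=> k ka; rewrite !mxE (negbTE ka) mulr0.
    move=> k kb; rewrite mxE big1 ?mul0r// => l _.
    by rewrite !mxE (negbTE kb) andbF mulr0.
  have -> : forall M1 M2 M3 : 'M[R]_1, (M1 + x *: M2 + x *: M3) 0 0 =
      M1 0 0 + x * M2 0 0 + x * M3 0 0 by move=> *; rewrite !mxE.
  rewrite !dl mxE; under eq_bigr do rewrite mxE -expr2.
  by ring.
have h : w i 0 ^+ 2 + w j 0 ^+ 2 <= \sum_k w k 0 ^+ 2.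
  rewrite (bigD1 i)//= (bigD1 j) ?[j == i]eq_sym//= addrA lerDl sumr_ge0// => k _.
  exact: sqr_ge0.
have s := sqr_ge0 (w i 0 + w j 0).
have : x * (w i 0 ^+ 2 + w j 0 ^+ 2) <= x * (\sum_k w k 0 ^+ 2) by exact: ler_wpM2l.
have : 0 <= x * (w i 0 + w j 0) ^+ 2 by exact: mulr_ge0.
move: (\sum_k _) => T; move: (w i 0) (w j 0) => u v; nra.
Qed.

Lemma centered_cov_quad x (v : 'cV[R]_n) :
  v^T *m A x *m v = (J *m v)^T *m P x *m (J *m v).
Proof. by rewrite /A trmx_mul centering_mx_sym !mulmxA. Qed.

Lemma centered_cov_psd x : 0 <= x <= 1 -> psd (A x).
Proof.
move=> /andP[x0 x1] v; rewrite centered_cov_quad.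
apply: le_trans (corr_mx_coercive _ x0); rewrite mulr_ge0 ?subr_ge0//.
by rewrite sumr_ge0// => k _; rewrite sqr_ge0.
Qed.

Lemma centered_cov_trace x : \tr (A x) = n%:R - 1 - 2 * x / n%:R.
Proof.
rewrite /mxtrace.
transitivity (\sum_(a < n) (1 - (1 + x * m a) * (2 / n%:R) + (n%:R + 2 * x) / n%:R ^+ 2)).
  apply: eq_bigr => a _; rewrite centered_covE corr_mxE eqxx.
  have -> : (a == i) && (a == j) = false.
    by apply/negbTE; apply: contra ij => /andP[/eqP <- /eqP <-].
  have -> : (a == j) && (a == i) = false.
    by apply/negbTE; apply: contra ij => /andP[/eqP <- /eqP <-].
  by rewrite /=; field.
rewrite big_split /= sumr_const card_ord sumrB -mulr_suml sum_m sumr_const card_ord.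
rewrite -[_ / _ ^+ 2 *+ n]mulr_natr.
by field.
Qed.

(** The kernel is the line of constant vectors: on a kernel vector the quadratic form vanishes, so
    by coercivity its centered version is zero. *)
Lemma centered_cov_rank x : 0 <= x < 1 -> \rank (A x) = n.-1.
Proof.
move=> /andP[x0 x1].
have n0 : (0 < n)%N by rewrite (ltn_trans _ n_gt2).
have A1 : A x *m (const_mx 1 : 'cV[R]_n) = 0.
  by rewrite /A -mulmxA centering_mx_ones mulmx0.
have h1 : (kermx (A x) <= (const_mx 1 : 'rV[R]_n))%MS.
  apply/rV_subP => u /sub_kermxP uA.
  have : (u *m A x *m u^T) 0 0 = 0 by rewrite uA mul0mx mxE.
  rewrite -{1}[u]trmxK centered_cov_quad => q0.
  have := corr_mx_coercive (J *m u^T) x0; rewrite q0 => le0.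
  have s0 : \sum_k (J *m u^T) k 0 ^+ 2 = 0.
    apply/eqP; rewrite eq_le sumr_ge0 ?andbT; last by move=> k _; exact: sqr_ge0.
    by move: le0; rewrite pmulr_rle0// subr_gt0.
  have w0 k : (J *m u^T) k 0 = 0.
    apply/eqP; rewrite -sqrf_eq0; move/eqP: s0; rewrite psumr_eq0.
      by move=> /allP/(_ k (mem_index_enum _)).
    by move=> l _; exact: sqr_ge0.
  have uE : u = (n%:R^-1 * \sum_k u 0 k) *: const_mx 1.
    apply/rowP => k; have := w0 k; rewrite mulmxBl mul1mx -scalemxAl.
    rewrite !mxE mulr1 => /eqP; rewrite subr_eq0 => /eqP ->; congr (_ * _).
    by apply: eq_bigr => l _; rewrite !mxE mul1r.
  by rewrite uE scalemx_sub.
have h2 : ((const_mx 1 : 'rV[R]_n) <= kermx (A x))%MS.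
  by apply/sub_kermxP; apply: trmx_inj; rewrite trmx_mul centered_cov_sym trmx_const A1 trmx0.
have r1 : \rank (const_mx 1 : 'rV[R]_n) = 1%N.
  apply/eqP; rewrite eqn_leq rank_leq_row lt0n mxrank_eq0.
  apply/eqP => /rowP/(_ (Ordinal n0)); rewrite !mxE => /eqP; exact/negP/oner_neq0.
have : \rank (kermx (A x)) = 1%N.
  by apply/eqP; rewrite eqn_leq -[in X in (_ <= X)%N && _]r1 mxrankS//= -r1 mxrankS.
rewrite mxrank_ker => e; have := rank_leq_row (A x).
by rewrite -[in RHS](subnK (rank_leq_row (A x))) e add1n.
Qed.

End PerturbedCovariance.

(** * Slope estimates and the arithmetic of a single triple *)

Section Slopes.
Variable R : realType.

Lemma gram_of_scale (k d1 d2 d3 : R) :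
  gram_of (k * d1) (k * d2) (k * d3) = k ^+ 2 * gram_of d1 d2 d3.
Proof. by rewrite /gram_of; field. Qed.

(** Because of this homogeneity the trace normalization does not influence orderings. *)
Lemma slope_scale (k d1 d2 d3 : R) : 0 < k -> 0 < gram_of d1 d2 d3 ->
  slope (k * d1) (k * d2) (k * d3) = slope d1 d2 d3.
Proof.
move=> k0 g0; rewrite /slope gram_of_scale sqrtrM ?sqr_ge0// sqrtr_sqr gtr0_norm//.
have : Num.sqrt (gram_of d1 d2 d3) != 0 by rewrite gt_eqF// sqrtr_gt0.
by move: (Num.sqrt _) => u u0; field; rewrite u0 gt_eqF.
Qed.

Lemma slopeC (d1 d2 d3 : R) : slope d1 d2 d3 = slope d2 d1 d3.
Proof.
rewrite /slope (_ : gram_of d1 d2 d3 = gram_of d2 d1 d3); last by rewrite /gram_of; ring.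
by congr (_ / _ / _); ring.
Qed.

(** The interval contains [1] and [1 - x] for [x <= 3 / 32], the only values the rescaled distances
    take. *)
Lemma gram_of_gt0 (d1 d2 d3 : R) : 7 / 8 <= d1 <= 1 -> 7 / 8 <= d2 <= 1 ->
  7 / 8 <= d3 <= 1 -> 0 < gram_of d1 d2 d3.
Proof. by rewrite /gram_of; nra. Qed.

(** The third distance separates the extreme alternatives, so this is the case of the perturbed pair
    at both ends. The difference of the two roots is controlled through the difference of their
    squares. *)
Lemma slope_apex_lipschitz (x : R) : 0 <= x <= 3 / 32 ->
  `|slope 1 1 (1 - x) - slope 1 1 1| <= x.
Proof.
move=> /andP[x0 x1].
rewrite /slope (_ : gram_of 1 1 (1 - x) = (3 - 2 * x - x ^+ 2) / 4); last first.
  by rewrite /gram_of; field.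
rewrite (_ : gram_of 1 1 1 = 3 / 4); last by rewrite /gram_of; field.
set K := (X in Num.sqrt X).
(* [16 / 25] is a convenient perfect square below both radicands, so both roots are at least
   [4 / 5]. *)
have K0 : 16 / 25 <= K by rewrite /K; nra.
set w := Num.sqrt K; set r := Num.sqrt (3 / 4).
have w2 : w ^+ 2 = K by rewrite sqr_sqrtr//; lra.
have r2 : r ^+ 2 = 3 / 4 by rewrite sqr_sqrtr//; lra.
have w0 : 0 <= w by exact: sqrtr_ge0.
have r0 : 0 <= r by exact: sqrtr_ge0.
have w4 : 4 / 5 <= w by rewrite leNgt; apply/negP => wl; nra.
have r4 : 4 / 5 <= r by rewrite leNgt; apply/negP => rl; nra.
have e : (r - w) * (r + w) = (2 * x + x ^+ 2) / 4.
  rewrite (_ : _ * _ = r ^+ 2 - w ^+ 2); last by ring.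
  by rewrite r2 w2 /K; field.
have rw0 : 0 <= r - w by rewrite leNgt; apply/negP => rl; nra.
have rwx : r - w <= 2 / 5 * x by rewrite leNgt; apply/negP => rl; nra.
have wn0 : w != 0 by rewrite gt_eqF//; lra.
have rn0 : r != 0 by rewrite gt_eqF//; lra.
rewrite (_ : _ - _ = - ((x * r + (r - w)) / (2 * w * r))); last by field; rewrite wn0 rn0.
have p : 0 < 2 * w * r by rewrite !mulr_gt0//; lra.
rewrite normrN ger0_norm; last by rewrite divr_ge0 ?(ltW p)// addr_ge0// mulr_ge0.
rewrite ler_pdivrMr//.
have xr : 0 <= x * r by exact: mulr_ge0.
have : x * r * (8 / 5) <= x * r * (2 * w) by rewrite ler_wpM2l//; lra.
have : x * (4 / 5) <= x * r by rewrite ler_wpM2l.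
rewrite (_ : x * (2 * w * r) = x * r * (2 * w)); last by ring.
lra.
Qed.

End Slopes.

(** With [u = 1/6 + h] and [v = 1/6 - h/2], the left side is [1 + 18 h^2], at most [1 + 9/8 x^2]. *)
Lemma chi2_arith (R : realType) (u v x : R) : 2 * u + 4 * v = 1 ->
  `|u - 1 / 6| <= x / 4 -> 6 * (2 * u ^+ 2 + 4 * v ^+ 2) <= 1 + 4 / 3 * x ^+ 2.
Proof.
move=> uv h; have -> : v = 1 / 4 - u / 2 by lra.
have x0 : 0 <= x / 4 := le_trans (normr_ge0 _) h.
have : (u - 1 / 6) ^+ 2 <= (x / 4) ^+ 2.
  by rewrite -[leLHS]real_normK ?num_real// ler_pXn2r ?nnegrE.
have := sqr_ge0 x; nra.
Qed.

(** Two permutations put [p] and [q] at the two ends and four make them adjacent; the symmetry of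
    [F] merges the latter. *)
Lemma sum_perm3_pair (R : realType) (F : R -> R -> R -> R) (y : R) (p q : 'I_3) :
  (forall d1 d2 d3, F d1 d2 d3 = F d2 d1 d3) -> p != q ->
  let e (a b : 'I_3) : R :=
    if ((a == p) && (b == q)) || ((a == q) && (b == p)) then y else 1 in
  \sum_(s : 'S_3) F (e (s 0) (s 1)) (e (s 1) (s 2)) (e (s 0) (s 2)) =
  2 * F 1 1 y + 4 * F y 1 1.
Proof.
move=> FC pq e; rewrite (sum_perm3 (fun a b c => F (e a b) (e b c) (e a c))) /e.
case: p pq {e} => -[|[|[|//]]] hp; case: q => -[|[|[|//]]] hq //= _;
  rewrite [F 1 y 1]FC; ring.
Qed.

(** * The normalized perturbed model *)

Section Perturbation.
Variables (R : realType) (n : nat) (i j : 'I_n).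
Hypothesis n_gt2 : (2 < n)%N.
Hypothesis ij : i != j.
Local Notation S := (@perturbed_cov R n i j).

Let nR_ge3 : 3 <= n%:R :> R.
Proof. by rewrite (ler_nat _ 3). Qed.

Let trace_gt0 (x : R) : 0 <= x < 1 -> 0 < n%:R - 1 - 2 * x / n%:R.
Proof.
move=> /andP[x0 x1]; have N3 := nR_ge3.
have : 2 * x / n%:R < 1 by rewrite ltr_pdivrMr; lra.
lra.
Qed.

Let scale_gt0 (x : R) : 0 <= x < 1 -> 0 < n%:R / (n%:R - 1 - 2 * x / n%:R).
Proof. by move=> /trace_gt0 t0; have N3 := nR_ge3; rewrite divr_gt0//; lra. Qed.

Lemma perturbed_covE x a b : S x a b =
  n%:R / (n%:R - 1 - 2 * x / n%:R) * centered_cov i j x a b.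
Proof. by rewrite /perturbed_cov mxE. Qed.

Lemma perturbed_cov_sym x : (S x)^T = S x.
Proof. by rewrite /perturbed_cov linearZ /= centered_cov_sym. Qed.

Lemma perturbed_cov_psd x : 0 <= x < 1 -> psd (S x).
Proof.
move=> x01 v; rewrite /perturbed_cov -scalemxAr -scalemxAl mxE.
have h : psd (centered_cov i j x).
  by apply: centered_cov_psd => //; case/andP: x01 => -> /ltW.
by rewrite mulr_ge0 ?h// ltW// scale_gt0.
Qed.

Lemma perturbed_cov_normalized x : 0 <= x < 1 -> normalized 0 (S x).
Proof.
move=> x01; split.
- by apply: big1 => k _; rewrite mxE.
- exact: perturbed_cov_sym.
- exact: perturbed_cov_psd.
- by rewrite /perturbed_cov -scalemxAl /centered_cov -mulmxA centering_mx_ones ?mulmx0 ?scaler0.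
- split; first by rewrite /perturbed_cov linearZ /= centered_cov_trace// divfK// gt_eqF// trace_gt0.
  rewrite /perturbed_cov (eqmx_scale _ _) ?centered_cov_rank//.
  by rewrite gt_eqF// scale_gt0.
Qed.

Lemma perturbed_cov_gap x : 0 <= x < 1 -> 2 / 3 * x <= S x i j - S 0 i j.
Proof.
move=> x01; have t0 := trace_gt0 x01; have /andP[x0 x1] := x01.
rewrite !perturbed_covE !centered_covE// !corr_mxE !eqxx (negbTE ij) [j == i]eq_sym (negbTE ij) /=.
move: t0 nR_ge3; move: (n%:R : R) => N t0 N3.
have N2 : 0 < N ^+ 2 - N - 2 * x by nra.
have Nn0 : N != 0 by rewrite gt_eqF//; lra.
have N1 : 0 < N - 1 by lra.
rewrite (_ : _ - _ = x * ((N - 2) * (N ^+ 2 - N + 2)) / ((N - 1) * (N ^+ 2 - N - 2 * x))); last first.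
  field; rewrite Nn0 gt_eqF//= gt_eqF//; nra.
rewrite ler_pdivlMr ?mulr_gt0//.
set Q := (N - 1) * _; rewrite (_ : 2 / 3 * x * Q = x * (2 / 3 * Q)); last by ring.
apply: ler_wpM2l => //.
(* The claimed inequality has slack one third of this product plus [4 / 3] of the next one. The
   factor [2 / 3] is sharp at [N = 3], [x = 0]. *)
have : 0 <= (N - 3) * (N ^+ 2 - 2 * N + 4) by apply: mulr_ge0; nra.
have : 0 <= (N - 1) * x by apply: mulr_ge0 => //; lra.
rewrite /Q; nra.
Qed.

Definition special (a b : 'I_n) : bool :=
  ((a == i) && (b == j)) || ((a == j) && (b == i)).

(** Centering fixes [e_a - e_b], so the variance of a difference is, up to the scale factor, that of
    [I + x M]. *)
Lemma perturbed_cov_sqdist x (a b : 'I_n) : a != b -> sqdist (S x) a b =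
  n%:R / (n%:R - 1 - 2 * x / n%:R) * 2 * (if special a b then 1 - x else 1).
Proof.
move=> ab; rewrite /sqdist !perturbed_covE !centered_covE// !corr_mxE !eqxx.
rewrite (negbTE ab) [b == a]eq_sym (negbTE ab) /special.
have f (c : 'I_n) : (c == i) && (c == j) = false.
  by apply/negbTE; apply: contra ij => /andP[/eqP <- /eqP <-].
rewrite ![(_ == j) && (_ == i)]andbC !f.
have : ~~ (((a == i) && (b == j)) && ((a == j) && (b == i))).
  by apply: contra ij => /andP[/andP[/eqP<- _] /andP[/eqP<- _]].
rewrite ![(b == i) && _]andbC.
by case: ((a == i) && (b == j)); case: ((a == j) && (b == i)) => //= _; ring.
Qed.

Lemma tnth_trip_inj (t : Trip n) : injective (tnth (trip_idx t)).
Proof.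
move=> a b; rewrite !(tnth_nth i) /=; case: t => -[[u v] w] /= /andP[uv vw].
have uw := ltn_trans uv vw.
by case: a => -[|[|[|//]]] ha; case: b => -[|[|[|//]]] hb /= e;
  apply/val_inj => //=; move: uv vw uw; rewrite ?e ?ltnn.
Qed.

(** Keeps [ordprob] away from its default value 0. The submatrix is a compression [E^T S E], hence
    positive semidefinite. *)
Lemma sub3_perturbed_cov_sqrt x (t : Trip n) : 0 <= x < 1 ->
  exists B : 'M[R]_3, B *m B^T = sub3 t (S x).
Proof.
move=> x01; apply: psd_sqrt.
  apply/matrixP => a b; rewrite [LHS]mxE [LHS]mxE [RHS]mxE.
  by rewrite -[in LHS](perturbed_cov_sym x) mxE.
move=> v; pose E : 'M[R]_(n, 3) := \matrix_(k, a) (k == tnth (trip_idx t) a)%:R.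
have -> : sub3 t (S x) = E^T *m S x *m E.
  apply/matrixP => a b; rewrite [LHS]mxE [RHS]mxE (bigD1 (tnth (trip_idx t) b))//= big1 ?addr0; last first.
    by move=> k /negbTE kb; rewrite [E _ _]mxE kb mulr0.
  rewrite [E _ _]mxE eqxx mulr1 [(E^T *m _) _ _]mxE (bigD1 (tnth (trip_idx t) a))//= big1 ?addr0; last first.
    by move=> k /negbTE kb; rewrite [E^T _ _]mxE [E _ _]mxE kb mul0r.
  by rewrite [E^T _ _]mxE [E _ _]mxE eqxx mul1r.
have := perturbed_cov_psd x01 (E *m v).
by rewrite trmx_mul !mulmxA.
Qed.

Let sum_const6 (c : R) : \sum_(s : 'S_3) c = 6 * c.
Proof. by rewrite sumr_const card_Sn mulr_natl. Qed.

(** * Ordering probabilities within one triple *)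

Section Triple.
Variables (x : R) (t : Trip n).
Hypothesis x_range : 0 <= x <= 3 / 32.
(** For distinct indices, the squared distances divided by their common factor [k]; on the diagonal
    the value is 1 instead of 0. *)
Let e (a b : 'I_3) : R :=
  if special (tnth (trip_idx t) a) (tnth (trip_idx t) b) then 1 - x else 1.
Let d (a b : 'I_3) := sqdist (S x) (tnth (trip_idx t) a) (tnth (trip_idx t) b).
Let k := n%:R / (n%:R - 1 - 2 * x / n%:R) * 2.

Let x01 : 0 <= x < 1.
Proof. by case/andP: x_range => -> ?; lra. Qed.

Let k_gt0 : 0 < k.
Proof. by rewrite mulr_gt0// scale_gt0. Qed.

Let dE a b : a != b -> d a b = k * e a b.
Proof. by move=> ab; rewrite /d perturbed_cov_sqdist// (inj_eq (@tnth_trip_inj t)). Qed.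

Let gram_e a b c a' b' c' : 0 < gram_of (e a a') (e b b') (e c c').
Proof. by move: x_range => xr; apply: gram_of_gt0; rewrite /e; case: ifP => _; lra. Qed.

Let perm3_neq (s : 'S_3) : [/\ s 0 != s 1, s 1 != s 2 & s 0 != s 2].
Proof. by split; rewrite (inj_eq perm_inj). Qed.

Lemma ordprob_perturbed (s : 'S_3) : ordprob 0 (S x) t s =
  fine (wedge (slope (e (s 0) (s 1)) (e (s 1) (s 2)) (e (s 0) (s 2)))).
Proof.
have [s01 s12 s02] := perm3_neq s.
transitivity (fine (wedge (slope (d (s 0) (s 1)) (d (s 1) (s 2)) (d (s 0) (s 2))))).
  apply: ordprob_slope; first exact: sub3_perturbed_cov_sqrt.
  have : 0 < gram_of (d (s 0) (s 1)) (d (s 1) (s 2)) (d (s 0) (s 2)); last by [].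
  rewrite (dE s01) (dE s12) (dE s02) gram_of_scale.
  by rewrite mulr_gt0 ?exprn_gt0 ?gram_e.
rewrite (dE s01) (dE s12) (dE s02) slope_scale; [by []|exact: k_gt0|exact: gram_e].
Qed.

Lemma ordprob_perturbed_sum : \sum_(s : 'S_3) ordprob 0 (S x) t s = 1.
Proof.
apply: ordprob_sum; first exact: sub3_perturbed_cov_sqrt.
rewrite -/(d _ _) -/(d _ _) -/(d _ _) !dE// gram_of_scale.
by rewrite mulr_gt0 ?exprn_gt0 ?gram_e.
Qed.

(** All rescaled distances equal 1, so the six orderings share one slope, and their probabilities
    sum to 1. *)
Lemma ordprob_perturbed_uniform (s : 'S_3) :
  (x == 0) || ~~ (in_trip t i && in_trip t j) -> ordprob 0 (S x) t s = 1 / 6.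
Proof.
move=> h.
have e1 a b : e a b = 1.
  rewrite /e; case: ifP => // sp; case/orP: h => [/eqP ->|]; first by rewrite subr0.
  suff -> : in_trip t i && in_trip t j by [].
  by case/orP: sp => /andP[/eqP <- /eqP <-]; rewrite /in_trip !mem_tnth.
have p s' : ordprob 0 (S x) t s' = fine (wedge (slope 1 1 (1 : R))).
  by rewrite ordprob_perturbed !e1.
have := ordprob_perturbed_sum; under eq_bigr do rewrite p.
by rewrite p sum_const6; move: (fine _) => w ?; lra.
Qed.

(* The two orderings with the third alternative in the middle have a common
   probability [u], the four others a common probability [v]. *)
Lemma ordprob_perturbed_sum_fun (g : R -> R) : in_trip t i && in_trip t j ->
  \sum_(s : 'S_3) g (ordprob 0 (S x) t s) =
  2 * g (fine (wedge (slope 1 1 (1 - x)))) +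
  4 * g (fine (wedge (slope (1 - x) 1 1))).
Proof.
move=> /andP[/tnthP[pi ti] /tnthP[pj tj]].
have pij : pi != pj by apply: contra ij => /eqP pij; rewrite ti tj pij.
have eE a b : e a b =
    if ((a == pi) && (b == pj)) || ((a == pj) && (b == pi)) then 1 - x else 1.
  by rewrite /e /special ti tj !(inj_eq (@tnth_trip_inj t)).
pose F d1 d2 d3 := g (fine (wedge (slope d1 d2 d3))).
have FC d1 d2 d3 : F d1 d2 d3 = F d2 d1 d3 by rewrite /F slopeC.
rewrite -[RHS](sum_perm3_pair (1 - x) FC pij).
by apply: eq_bigr => s _; rewrite ordprob_perturbed !eE.
Qed.

End Triple.

(** A wedge of angle 60 degrees. Its mass is read off the unperturbed model instead of being
    integrated. *)
Lemma wedge_equilateral (t : Trip n) : fine (wedge (slope 1 1 (1 : R))) = 1 / 6.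
Proof.
have x0 : is_true (0 <= (0 : R) <= 3 / 32) by lra.
have e1 (b : bool) : (if b then 1 - 0 else 1) = 1 :> R by rewrite subr0 if_same.
transitivity (ordprob 0 (S 0) t 1%g).
  by rewrite (ordprob_perturbed t x0) !e1.
by apply: ordprob_perturbed_uniform; [exact: x0|rewrite eqxx].
Qed.

(** The left side is the second moment of the likelihood ratio against the uniform law. The
    Lipschitz bounds for [slope] and [wedge] together place the probability [u] within [x / 4] of
    [1 / 6]. *)
Lemma ordprob_perturbed_chi2 x (t : Trip n) : 0 <= x <= 3 / 32 ->
  6 * (\sum_(s : 'S_3) ordprob 0 (S x) t s ^+ 2) <=
  1 + (if in_trip t i && in_trip t j then 4 / 3 * x ^+ 2 else 0).
Proof.
move=> xr; case: ifP => tij; last first.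
  under eq_bigr do rewrite (ordprob_perturbed_uniform xr) ?tij ?orbT//.
  by rewrite sum_const6; lra.
rewrite (ordprob_perturbed_sum_fun xr (fun p => p ^+ 2) tij).
apply: chi2_arith.
- rewrite -[RHS](ordprob_perturbed_sum t xr).
  by rewrite (ordprob_perturbed_sum_fun xr id tij).
- rewrite -(wedge_equilateral t); apply: le_trans (wedge_lipschitz _ _) _.
  by rewrite ler_pM2r ?invr_gt0 ?ltr0n// slope_apex_lipschitz.
Qed.

End Perturbation.

(** * Sums of products over independent samples *)

Section ProductSums.
Variable R : realType.

Lemma sum_tuple_prod (T : finType) (k : nat) (f : T -> R) :
  \sum_(u : k.-tuple T) \prod_(a < k) f (tnth u a) = (\sum_s f s) ^+ k.
Proof.
transitivity (\prod_(a < k) \sum_s f s); last first.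
  by rewrite prodr_const card_ord.
rewrite bigA_distr_bigA (reindex (fun u : k.-tuple T => [ffun a => tnth u a])).
  by apply: eq_bigr => u _; apply: eq_bigr => a _; rewrite ffunE.
apply/onW_bij; exists (fun g : {ffun 'I_k -> T} => [tuple g a | a < k]).
- by move=> u; apply: eq_from_tnth => a; rewrite tnth_mktuple ffunE.
- by move=> g; apply/ffunP => a; rewrite ffunE tnth_mktuple.
Qed.

(** Distributivity with factors ranging over different types: they are gathered in a tagged sum, and
    [fprod] is in bijection with the dependent functions. *)
Lemma sum_dffun_prod (I : finType) (T : I -> finType) (G : forall t, T t -> R) :
  \sum_(d : {dffun forall t, T t}) \prod_t G t (d t) = \prod_t \sum_u G t u.
Proof.
pose P t : {ffun T t -> R} := [ffun u => G t u].
transitivity (\prod_t \sum_(j in tagged_with T t) untag 0 (P t) j); last first.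
  apply: eq_bigr => t _; rewrite -(big_tag (fun t => P t : T t -> R)).
  by apply: eq_bigr => u _; rewrite ffunE.
rewrite bigA_distr_big_dep.
transitivity (\sum_(f : fprod T) \prod_(t in I) P t (f t)); last exact: big_fprod.
rewrite (reindex (@dffun_of_fprod I T)); last exact/onW_bij/dffun_of_fprod_bij.
apply: eq_bigr => d _; apply: eq_bigr => t _.
by rewrite !ffunE.
Qed.

Lemma sum_data (n : nat) (N : Trip n -> nat) (w : Trip n -> 'S_3 -> R) :
  \sum_(d : Data N) \prod_(t : Trip n) \prod_(a < N t) w t (tnth (d t) a) =
  \prod_(t : Trip n) (\sum_s w t s) ^+ N t.
Proof.
rewrite (sum_dffun_prod (fun t (u : (N t).-tuple 'S_3) => \prod_(a < N t) w t (tnth u a))).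
by apply: eq_bigr => t _; exact: sum_tuple_prod.
Qed.

End ProductSums.

(** * The entrywise maximum norm *)

Section MaxNorm.
Variables (R : realType) (n : nat).

Lemma maxnorm_ge0 (A : 'M[R]_n) : 0 <= maxnorm A.
Proof. by rewrite /maxnorm; elim/big_rec: _ => // k y _ y0; rewrite le_max y0 orbT. Qed.

Lemma le_maxnorm (A : 'M[R]_n) i j : `|A i j| <= maxnorm A.
Proof.
apply: le_trans (le_bigmax _ _ i).
exact: (le_bigmax _ (fun j => `|A i j|) j).
Qed.

Lemma maxnorm_le (A : 'M[R]_n) c : 0 <= c -> (forall i j, `|A i j| <= c) ->
  maxnorm A <= c.
Proof. by move=> c0 h; apply: bigmax_le => // i _; apply: bigmax_le. Qed.

Lemma ler_maxnormD (A B : 'M[R]_n) : maxnorm (A + B) <= maxnorm A + maxnorm B.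
Proof.
apply: maxnorm_le => [|i j]; first by rewrite addr_ge0 ?maxnorm_ge0.
rewrite mxE; apply: le_trans (ler_normD _ _) _.
by rewrite lerD ?le_maxnorm.
Qed.

Lemma maxnormN (A : 'M[R]_n) : maxnorm (- A) = maxnorm A.
Proof.
by rewrite /maxnorm; apply: eq_bigr => i _; apply: eq_bigr => j _; rewrite mxE normrN.
Qed.

End MaxNorm.

(** * Change of measure by Cauchy-Schwarz *)

Section TwoPoint.
Variable R : realType.

(* Second moment of the likelihood ratio of [q] with respect to the uniform
   weight [1 / c]: the Cauchy-Schwarz bound behind the chi-square method. *)
Lemma uniform_change_of_measure (D : finType) (E : pred D) (q : D -> R) (c : R) : 0 < c ->
  (\sum_(d | E d) q d) ^+ 2 <= (\sum_(d | E d) c^-1) * (c * \sum_d q d ^+ 2).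
Proof.
move=> c0; set Q := \sum_(d | E d) q d; set m := \sum_(d | E d) (1 : R).
have mE : \sum_(d | E d) c^-1 = m * c^-1.
  by rewrite /m mulr_suml; apply: eq_bigr => d _; rewrite mul1r.
rewrite mE mulrA mulfVK ?gt_eqF//.
have le_sub : \sum_(d | E d) q d ^+ 2 <= \sum_d q d ^+ 2.
  rewrite [leRHS](bigID E) /= lerDl sumr_ge0// => d _; exact: sqr_ge0.
have m0 : 0 <= m by rewrite sumr_ge0.
apply: le_trans (ler_wpM2l m0 le_sub).
have [m00|mn0] := eqVneq m 0.
  have E0 d : E d -> False.
    move=> Ed; move/eqP: m00; rewrite psumr_eq0// => /allP/(_ d (mem_index_enum _)).
    by rewrite Ed oner_eq0.
  by rewrite /Q big_pred0 ?expr0n ?m00 ?mul0r// => d; apply/negP => /E0.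
(* [Q / m] is the mean of [q] over [E]; Cauchy-Schwarz is the nonnegativity of this variance. *)
have : 0 <= \sum_(d | E d) (q d - Q / m) ^+ 2 by rewrite sumr_ge0// => d _; exact: sqr_ge0.
rewrite (eq_bigr (fun d => q d ^+ 2 - 2 * (Q / m) * q d + (Q / m) ^+ 2 * 1)); last first.
  by move=> d _; ring.
rewrite big_split sumrB /= -!mulr_sumr -/Q -/m.
move: (\sum_(d | E d) q d ^+ 2) => W h.
have := mulr_ge0 m0 h.
by rewrite (_ : m * _ = m * W - Q ^+ 2) ?subr_ge0//; field.
Qed.

End TwoPoint.

(** * Likelihood of the whole data set *)

Section DataLikelihood.
Variables (R : realType) (n : nat) (i j : 'I_n).
Hypothesis n_gt2 : (2 < n)%N.
Hypothesis ij : i != j.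
Variable N : Trip n -> nat.
Local Notation S := (@perturbed_cov R n i j).

(** The number of possible data sets, so that [c^-1] is the uniform weight. *)
Let c : R := \prod_(t : Trip n) 6 ^+ N t.

Let c_gt0 : 0 < c.
Proof. by apply: prodr_gt0 => t _; rewrite exprn_gt0. Qed.

Lemma data_prob_unperturbed (d : Data N) : data_prob 0 (S 0) d = c^-1.
Proof.
rewrite /data_prob /c -prodfV; apply: eq_bigr => t _.
rewrite (eq_bigr (fun=> 6^-1)); last first.
  move=> a _; rewrite (ordprob_perturbed_uniform n_gt2 ij) ?div1r ?eqxx//.
  by apply/andP; split; [exact: lexx|apply: divr_ge0; exact: ler0n].
by rewrite prodr_const card_ord exprVn.
Qed.

Variable x : R.
Hypothesis x_range : 0 <= x <= 3 / 32.

Lemma data_prob_perturbed_sum : \sum_(d : Data N) data_prob 0 (S x) d = 1.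
Proof.
rewrite (sum_data N (ordprob 0 (S x))) big1// => t _.
by rewrite (ordprob_perturbed_sum n_gt2 ij)// expr1n.
Qed.

(** The second moment factors over samples. Samples containing [i] and [j] contribute at most
    [1 + 4/3 x^2 <= exp (4/3 x^2)] each, the others at most 1. *)
Lemma data_prob_perturbed_chi2 :
  c * \sum_(d : Data N) data_prob 0 (S x) d ^+ 2 <=
  expR (4 / 3 * x ^+ 2 * (Npair N i j)%:R).
Proof.
have -> : \sum_(d : Data N) data_prob 0 (S x) d ^+ 2 =
    \prod_(t : Trip n) (\sum_s ordprob 0 (S x) t s ^+ 2) ^+ N t.
  rewrite -(sum_data N (fun t s => ordprob 0 (S x) t s ^+ 2)).
  apply: eq_bigr => d _; rewrite /data_prob -prodrXl.
  by apply: eq_bigr => t _; rewrite -prodrXl.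
rewrite /c -big_split /= /Npair natr_sum mulr_sumr expR_sum big_mkcond /=.
rewrite [leRHS]big_mkcond /=.
apply: ler_prod => t _.
rewrite -exprMn exprn_ge0 /=; last first.
  by rewrite mulr_ge0// sumr_ge0// => s _; exact: sqr_ge0.
have le := ordprob_perturbed_chi2 n_gt2 ij t x_range.
set u := 6 * _ in le *.
have u0 : 0 <= u by rewrite mulr_ge0// sumr_ge0// => s _; exact: sqr_ge0.
move: le; case: ifP => _ le.
  rewrite expRM_natr lerXn2r ?nnegrE ?expR_ge0//.
  exact: le_trans le (expR_ge1Dx _).
by rewrite -[leRHS](expr1n _ (N t)) lerXn2r ?nnegrE ?ler01//; lra.
Qed.

End DataLikelihood.

(** * The two-point lower bound *)

Theorem theorem5 (R : realType) (n : nat) (hn : (3 <= n)%N)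
  (delta eps : R)
  (hdelta : 0 < delta < 2^-4) (heps : 0 < eps < 2^-4)
  (N : Trip n -> nat) (T : Data N -> 'M[R]_n)
  (hN : exists i j : 'I_n, i != j /\
          ((Npair N i j)%:R <= eps ^-2 * ln (delta ^-1) / 4)) :
  exists S1 S2 : 'M[R]_n,
    [/\ normalized 0 S1, normalized 0 S2,
        \tr S1 = n%:R /\ \tr S2 = n%:R,
        eps <= maxnorm (S1 - S2) &
        delta <= Num.max
          (data_Pr 0 S1 (fun d => eps / 4 <= maxnorm (T d - S1)))
          (data_Pr 0 S2 (fun d => eps / 4 <= maxnorm (T d - S2)))].
Proof.
case: hN => i [j [ij Nij]].
have e16 : 2^-4 = 1 / 16 :> R by rewrite -natrX div1r.
move: hdelta heps; rewrite e16 => /andP[d0 d1] /andP[e0 e1].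
(* The entry gap [2 / 3 * x] is then [eps], and [eps < 1 / 16] keeps [x] below [3 / 32]. *)
pose x : R := 3 / 2 * eps.
have x_range : 0 <= x <= 3 / 32 by rewrite /x; lra.
have x01 : 0 <= x < 1 by lra.
have z01 : 0 <= (0 : R) < 1 by rewrite lexx ltr01.
have nS1 := perturbed_cov_normalized hn ij z01.
have nS2 := perturbed_cov_normalized hn ij x01.
set S1 := perturbed_cov i j 0 in nS1 *; set S2 := perturbed_cov i j x in nS2 *.
exists S1, S2.
have gap : eps <= maxnorm (S1 - S2).
  apply: le_trans (le_maxnorm _ i j); rewrite mxE [(- S2) i j]mxE distrC.
  apply: le_trans (ler_norm _); apply: le_trans (perturbed_cov_gap hn ij x01).
  by rewrite /x; lra.
split=> //; first by case: nS1 => _ _ _ _ [-> _]; case: nS2 => _ _ _ _ [-> _].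
set E1 : pred (Data N) := fun d => _; set E2 : pred (Data N) := fun d => eps / 4 <= maxnorm (T d - S2).
(* If both error probabilities were below [delta], the complement of [E2] would be likely under [S2]
   and rare under [S1]. *)
rewrite leNgt gt_max; apply/negP => /andP[p1 p2].
set c : R := \prod_(t : Trip n) 6 ^+ N t.
have c0 : 0 < c by apply: prodr_gt0 => t _; rewrite exprn_gt0.
(* An estimate within [eps / 4] of both matrices would place them less than [eps / 2] apart. *)
have cover d : ~~ E2 d -> E1 d.
  rewrite /E1 /E2 -ltNge => h2; rewrite leNgt; apply/negP => h1.
  have : maxnorm (S1 - S2) <= maxnorm (T d - S1) + maxnorm (T d - S2).
    rewrite -[maxnorm (T d - S1)]maxnormN; apply: le_trans (ler_maxnormD _ _).
    by rewrite opprB addrA subrK.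
  by lra.
have CS := uniform_change_of_measure [pred d | ~~ E2 d] (data_prob 0 S2) c0.
have q1 : \sum_(d | ~~ E2 d) data_prob 0 S2 d > 1 - delta.
  have := data_prob_perturbed_sum hn ij N x_range.
  rewrite (bigID E2) /=; move: p2; rewrite /data_Pr.
  by move: (\sum_(d | E2 d) _) (\sum_(d | ~~ E2 d) _) => u v; lra.
have q2 : \sum_(d | ~~ E2 d) c^-1 < delta.
  apply: le_lt_trans p1; rewrite /data_Pr.
  rewrite [leRHS](eq_bigr (fun=> c^-1)); last by move=> d _; exact: data_prob_unperturbed.
  rewrite [leRHS](bigID (fun d => ~~ E2 d)) /=.
  rewrite (eq_bigl (fun d => ~~ E2 d)); last first.
    by move=> d /=; apply/andP/idP => [[]//|h]; split=> //; exact: cover.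
  by rewrite lerDl sumr_ge0// => d _; rewrite invr_ge0 ltW.
have q3 := data_prob_perturbed_chi2 hn ij N x_range.
(* The fourth root of [delta]; the bound [delta^(-3/4)] becomes [r^(-3)]. *)
pose r := expR (- ln delta^-1 / 4).
have r0 : 0 < r by exact: expR_gt0.
have r4 : r ^+ 4 = delta.
  by rewrite -expRM_natr divfK// expRN lnK ?posrE ?invr_gt0// invrK.
(* Since [4/3 x^2 = 3 eps^2], the bound on [Npair] caps the exponent at [3/4 ln (1 / delta)]. *)
have q4 : expR (4 / 3 * x ^+ 2 * (Npair N i j)%:R) <= (r ^+ 3)^-1.
  rewrite -expRM_natr -expRN ler_expR /x.
  have e20 : 0 < 3 * eps ^+ 2 by rewrite mulr_gt0// exprn_gt0.
  have := ler_wpM2l (ltW e20) Nij.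
  have en0 : eps != 0 by rewrite gt_eqF.
  rewrite (_ : 3 * eps ^+ 2 * (eps ^- 2 * ln delta^-1 / 4) = 3 / 4 * ln delta^-1); last by field.
  by lra.
move: q3; rewrite -/c -/S2 => q3.
have {CS}CS : (\sum_(d | ~~ E2 d) data_prob 0 S2 d) ^+ 2 <= delta * (r ^+ 3)^-1.
  apply: le_trans CS _; apply: ler_pM => //.
  - by apply: sumr_ge0 => d _; rewrite invr_ge0 ltW.
  - by rewrite mulr_ge0 ?(ltW c0)// sumr_ge0// => d _; exact: sqr_ge0.
  - exact: ltW.
  - exact: le_trans q3 q4.
have : delta * (r ^+ 3)^-1 = r by rewrite -r4; field; rewrite gt_eqF.
(* Here [delta < 1 / 16] enters as [(1/2)^4]. The contradiction is [(15/16)^2 < Q^2 <= r < 1/2]. *)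
have rl : r < 1 / 2.
  rewrite ltNge; apply/negP => rh.
  have : (1 / 2) ^+ 4 <= r ^+ 4 by rewrite lerXn2r ?nnegrE//; lra.
  by rewrite r4; lra.
move: CS q1; move: (\sum_(d | ~~ E2 d) _) => Q CS q1 re; rewrite re in CS.
nra.
Qed.
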